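(* Let $K$ be a commutative unital ring, let $A$ be a unital associative $K$-algebra which is flat over $K$, and let $\theta$ be a unital action of an $E$-unitary inverse monoid $S$ on $A$. Then $(A\rtimes_\theta S)^e$ is flat as a left $A^e$-module and as a right $A^e$-module.
   Context: Inverse monoids and actions. For an inverse monoid $S$, $E(S)$ is its set of idempotents and $s\le t$ means $s=et$ for some $e\in E(S)$. $S$ is $E$-unitary if $e\le s$ with $e\in E(S)$ implies $s\in E(S)$. $\mathcal I(A)$ is the symmetric inverse monoid of all bijections between subsets of $A$. A unital action of $S$ on $A$ is a semigroup homomorphism $\theta:S\to\mathcal I(A)$, $s\mapsto\theta_s$, such that the domain and range of each $\theta_s$ are ideals of $A$, $\theta_s$ is an isomorphism of $K$-algebras from its domain onto its range, $\theta_{1_S}=\mathrm{id}_A$, and the range of $\theta_s$ is $1_sA$ for some central idempotent $1_s$ of $A$ (so $\theta_s:1_{s^{-1}}A\to 1_sA$). Crossed product. $L(A,\theta,S)=\bigoplus_{s\in S}1_sA\,\delta_s$ ($\delta_s$ are symbols) with product $a\delta_s\cdot b\delta_t=a\,\theta_s(1_{s^{-1}}b)\,\delta_{st}$ is an associative $K$-algebra; $\mathcal N$ is its ideal generated by all $a\delta_s-a\delta_t$ with $s\le t$ and $a\in 1_sA$. The crossed product is $A\rtimes_\theta S=L(A,\theta,S)/\mathcal N$; $\overline w$ denotes the class of $w$. The map $A\to A\rtimes_\theta S$, $a\mapsto\overline{a\delta_1}$, is an injective homomorphism of unital algebras, through which $A$ is regarded as a subalgebra of $A\rtimes_\theta S$.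 Enveloping algebras. For a unital $K$-algebra $R$, $R^e=R\otimes_K R^{\mathrm{op}}$. The left $A^e$-module structure on $(A\rtimes_\theta S)^e$ is $(a\otimes b)\cdot(x\otimes y)=ax\otimes yb$ and the right one is $(x\otimes y)\cdot(a\otimes b)=xa\otimes by$, where $a,b\in A$, $x,y\in A\rtimes_\theta S$ and the products $ax,yb,xa,by$ are taken in $A\rtimes_\theta S$. *)

(* Defs.v *)
From HB Require Import structures.
From mathcomp Require Import all_boot all_algebra.
From mathcomp Require Import boolp.
From mathcomp Require Import finmap monalg.

Set Implicit Arguments.
Unset Strict Implicit.
Unset Printing Implicit Defensive.

Import GRing.Theory.
Import Quotient.

Local Open Scope ring_scope.
Local Open Scope quotient_scope.

(* Unital associative K-algebras.  [algType K] is not used as the base notion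
   because it imposes [1 != 0], whereas the zero ring and the zero algebra are
   allowed here; every [algType K] is a [pzAlgType K] below.  HB admits no new
   join of [PzRing] and [Lmodule], hence a scaling operation of its own; the
   underlying K-module is [alg_mod A]. *)
HB.mixin Record isPzAlgebra (K : pzRingType) A of GRing.PzRing A := {
  ascale : K -> A -> A;
  ascaleA : forall (a b : K) (x : A), ascale a (ascale b x) = ascale (a * b) x;
  ascale1r : left_id 1 ascale;
  ascaleDr : right_distributive ascale +%R;
  ascaleDl : forall x : A, {morph ascale^~ x : a b / a + b};
  ascaleAl : forall (k : K) (x y : A), ascale k (x * y) = ascale k x * y;
  ascaleAr : forall (k : K) (x y : A), ascale k (x * y) = x * ascale k y
}.

#[short(type="pzAlgType")]
HB.structure Definition PzAlgebra (K : pzRingType) :=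
  {A of GRing.PzRing A & isPzAlgebra K A}.

Definition alg_mod (K : pzRingType) (A : pzAlgType K) : Type := A.

Section AlgebraInstances.
Variables (K : pzRingType).

HB.instance Definition _ (A : pzAlgType K) := GRing.Zmodule.on (alg_mod A).
HB.instance Definition _ (A : pzAlgType K) :=
  GRing.Zmodule_isLmodule.Build K (alg_mod A)
    (@ascaleA K A) (@ascale1r K A) (@ascaleDr K A) (@ascaleDl K A).

HB.instance Definition _ (A : pzAlgType K) :=
  isPzAlgebra.Build K A^c
    (@ascaleA K A) (@ascale1r K A) (@ascaleDr K A) (@ascaleDl K A)
    (fun k x y => ascaleAr k (y : A) (x : A))
    (fun k x y => ascaleAl k (y : A) (x : A)).

HB.instance Definition _ (A : algType K) :=
  isPzAlgebra.Build K A
    (@scalerA K A) (@scale1r K A) (@scalerDr K A)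
    (fun v a b => @scalerDl K A v a b)
    (@scalerAl K A) (@scalerAr K A).

Variable A : pzAlgType K.

Lemma ascaler0 (k : K) : ascale k 0 = 0 :> A.
Proof. exact: (@scaler0 K (alg_mod A)). Qed.
Lemma ascalerB (k : K) (x y : A) : ascale k (x - y) = ascale k x - ascale k y.
Proof. exact: (@scalerBr K (alg_mod A)). Qed.

End AlgebraInstances.

(* Additive extension to finitely supported functions of a family of
   additive maps. *)
Section MalgLift.
Variables (S : choiceType) (A V : zmodType).
Implicit Types (F : S -> A -> V) (f g : {malg A[S]}).

Definition mlift F f : V := \sum_(s <- msupp f) F s f@_s.

Section Additive.
Variable F : S -> A -> V.
Hypothesis FD : forall s, {morph F s : x y / x + y}.

Let F0 s : F s 0 = 0.
Proof. by apply: (addIr (F s 0)); rewrite -FD !add0r. Qed.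

Lemma mliftEw f (d : {fset S}) :
  (msupp f `<=` d)%fset -> mlift F f = \sum_(s <- d) F s f@_s.
Proof.
move=> le_fd; apply: big_fset_incl => // s _ sNf.
by rewrite mcoeff_outdom.
Qed.

Lemma mliftD : {morph mlift F : f g / f + g}.
Proof.
move=> f g; pose d := (msupp f `|` msupp g)%fset.
rewrite (@mliftEw (f + g) d) ?msuppD_le//.
rewrite (@mliftEw f d) ?fsubsetUl// (@mliftEw g d) ?fsubsetUr//.
by rewrite -big_split/=; apply: eq_bigr => s _; rewrite mcoeffD FD.
Qed.

Lemma mlift0 : mlift F 0 = 0.
Proof. by rewrite /mlift msupp0 big_seq_fset0. Qed.

Lemma mliftN : {morph mlift F : f / - f}.
Proof.
move=> f; apply: (addIr (mlift F f)).
by rewrite -mliftD !addNr mlift0.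
Qed.

Lemma mliftB : {morph mlift F : f g / f - g}.
Proof. by move=> f g; rewrite mliftD mliftN. Qed.

Lemma mliftU a s : mlift F << a *g s >> = F s a.
Proof.
rewrite (@mliftEw _ [fset s]%fset) ?msuppU_le// big_seq_fset1.
by rewrite mcoeffUU.
Qed.

End Additive.

Lemma eq_mlift F F' f : (forall s a, F s a = F' s a) -> mlift F f = mlift F' f.
Proof. by move=> eF; apply: eq_bigr => s _. Qed.

Lemma mliftDF F F' f :
  mlift (fun s a => F s a + F' s a) f = mlift F f + mlift F' f.
Proof. by rewrite /mlift big_split. Qed.

Lemma malg_ind (P : {malg A[S]} -> Prop) :
  P 0 -> (forall f g, P f -> P g -> P (f + g)) ->
  (forall a s, P << a *g s >>) -> forall f, P f.
Proof.
move=> P0 PD PU f; rewrite [f]monalgE.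
by elim/big_ind : _ => // s _; exact: PU.
Qed.

End MalgLift.

Section GeneratedSubgroup.
Variable V : zmodType.
Implicit Types (X H : V -> Prop).

Definition is_subgroup H : Prop :=
  H 0 /\ forall x y, H x -> H y -> H (x - y).

Definition gen_subgroup X : {pred V} :=
  [pred x | `[< forall H, is_subgroup H -> (forall y, X y -> H y) -> H x >]].

Lemma gen_subgroup_sub X x : X x -> x \in gen_subgroup X.
Proof. by move=> Xx; rewrite inE; apply/asboolP => H _; apply. Qed.

Lemma gen_subgroup_min X H x :
  is_subgroup H -> (forall y, X y -> H y) -> x \in gen_subgroup X -> H x.
Proof. by move=> sH XH; rewrite inE => /asboolP; apply. Qed.

Lemma gen_subgroup_closed X : zmod_closed (gen_subgroup X).
Proof.
split; first by rewrite inE; apply/asboolP => H [].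
move=> x y; rewrite !inE => /asboolP Hx /asboolP Hy.
apply/asboolP => H sH XH; case: (sH) => _; apply; [exact: Hx | exact: Hy].
Qed.

HB.instance Definition _ X :=
  GRing.isZmodClosed.Build V (gen_subgroup X) (gen_subgroup_closed X).

End GeneratedSubgroup.

Section IdealQuotient.
Variable R : pzRingType.
Implicit Types (X I : R -> Prop).

Definition is_ideal I : Prop :=
  [/\ I 0, forall x y, I x -> I y -> I (x - y),
      forall x y, I y -> I (x * y) & forall x y, I x -> I (x * y)].

Definition gen_ideal X : {pred R} :=
  [pred x | `[< forall I, is_ideal I -> (forall y, X y -> I y) -> I x >]].

Lemma gen_ideal_sub X x : X x -> x \in gen_ideal X.
Proof. by move=> Xx; rewrite inE; apply/asboolP => H _; apply. Qed.

Lemma gen_ideal_min X I x :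
  is_ideal I -> (forall y, X y -> I y) -> x \in gen_ideal X -> I x.
Proof. by move=> sI XI; rewrite inE => /asboolP; apply. Qed.

Lemma gen_ideal_closed X : zmod_closed (gen_ideal X).
Proof.
split; first by rewrite inE; apply/asboolP => H [].
move=> x y; rewrite !inE => /asboolP Hx /asboolP Hy.
apply/asboolP => H sH XH; case: (sH) => _ + _ _; apply.
  exact: Hx.
exact: Hy.
Qed.

HB.instance Definition _ X :=
  GRing.isZmodClosed.Build R (gen_ideal X) (gen_ideal_closed X).

Lemma gen_idealMl X x y : y \in gen_ideal X -> x * y \in gen_ideal X.
Proof.
rewrite !inE => /asboolP Hy; apply/asboolP => H sH XH.
by case: (sH) => _ _ + _; apply; exact: Hy.
Qed.

Lemma gen_idealMr X x y : x \in gen_ideal X -> x * y \in gen_ideal X.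
Proof.
rewrite !inE => /asboolP Hx; apply/asboolP => H sH XH.
by case: (sH) => _ _ _; apply; exact: Hx.
Qed.

Definition ideal_quot X := {quot (gen_ideal X)}.

HB.instance Definition _ X := GRing.Zmodule.on (ideal_quot X).

Variable X : R -> Prop.

Definition ideal_pi (x : R) : ideal_quot X := \pi_({quot (gen_ideal X)}) x.

Lemma ideal_piP x y : reflect (ideal_pi x = ideal_pi y) (x - y \in gen_ideal X).
Proof. by rewrite Quotient.idealrBE; apply: eqP. Qed.

Lemma ideal_pi_reprK (u : ideal_quot X) :
  ideal_pi (repr (u : {quot (gen_ideal X)})) = u.
Proof. exact: reprK. Qed.

Lemma ideal_quotW (P : ideal_quot X -> Prop) :
  (forall x, P (ideal_pi x)) -> forall u, P u.
Proof. by move=> PP u; rewrite -[u]ideal_pi_reprK; apply: PP. Qed.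

Lemma ideal_piD : {morph ideal_pi : x y / x + y}.
Proof. by move=> x y; rewrite /ideal_pi !piE. Qed.

Definition iq_one : ideal_quot X := ideal_pi 1.
Definition iq_mul (u v : ideal_quot X) : ideal_quot X :=
  ideal_pi (repr (u : {quot (gen_ideal X)}) * repr (v : {quot (gen_ideal X)})).

Lemma ideal_piM x y : ideal_pi (x * y) = iq_mul (ideal_pi x) (ideal_pi y).
Proof.
apply/ideal_piP; set x' := repr _; set y' := repr _.
have -> : x * y - x' * y' = (x - x') * y + x' * (y - y').
  by rewrite mulrBl mulrBr addrA subrK.
apply: rpredD.
  by apply: gen_idealMr; apply/ideal_piP; rewrite ideal_pi_reprK.
by apply: gen_idealMl; apply/ideal_piP; rewrite ideal_pi_reprK.
Qed.

Lemma iq_mulA : associative iq_mul.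
Proof.
elim/ideal_quotW => x; elim/ideal_quotW => y; elim/ideal_quotW => z.
by rewrite -!ideal_piM mulrA.
Qed.
Lemma iq_mul1r : left_id iq_one iq_mul.
Proof. by elim/ideal_quotW => x; rewrite -ideal_piM mul1r. Qed.
Lemma iq_mulr1 : right_id iq_one iq_mul.
Proof. by elim/ideal_quotW => x; rewrite -ideal_piM mulr1. Qed.
Lemma iq_mulDl : left_distributive iq_mul +%R.
Proof.
elim/ideal_quotW => x; elim/ideal_quotW => y; elim/ideal_quotW => z.
by rewrite -ideal_piD -!ideal_piM -ideal_piD mulrDl.
Qed.
Lemma iq_mulDr : right_distributive iq_mul +%R.
Proof.
elim/ideal_quotW => x; elim/ideal_quotW => y; elim/ideal_quotW => z.
by rewrite -ideal_piD -!ideal_piM -ideal_piD mulrDr.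
Qed.

HB.instance Definition _ := GRing.Zmodule_isPzRing.Build (ideal_quot X)
  iq_mulA iq_mul1r iq_mulr1 iq_mulDl iq_mulDr.

Lemma ideal_pi_is_zmod_morphism : zmod_morphism ideal_pi.
Proof. by move=> x y; rewrite /ideal_pi !piE. Qed.
Lemma ideal_pi_is_monoid_morphism : monoid_morphism ideal_pi.
Proof. by split=> // x y; rewrite ideal_piM. Qed.

HB.instance Definition _ :=
  GRing.isZmodMorphism.Build R (ideal_quot X) ideal_pi ideal_pi_is_zmod_morphism.
HB.instance Definition _ :=
  GRing.isMonoidMorphism.Build R (ideal_quot X) ideal_pi
    ideal_pi_is_monoid_morphism.

End IdealQuotient.

Section AlgebraQuotient.
Variables (K : pzRingType) (R : pzAlgType K) (X : R -> Prop).

Definition iq_scale (k : K) (u : ideal_quot X) : ideal_quot X :=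
  ideal_pi X (ascale k (repr (u : {quot (gen_ideal X)}))).

Lemma ideal_piZ k x : ideal_pi X (ascale k x) = iq_scale k (ideal_pi X x).
Proof.
apply/ideal_piP; set x' := repr _; rewrite -ascalerB -[x - x']mul1r ascaleAl.
by apply: gen_idealMl; apply/ideal_piP; rewrite ideal_pi_reprK.
Qed.

Fact iq_scaleA a b u : iq_scale a (iq_scale b u) = iq_scale (a * b) u.
Proof. by elim/ideal_quotW: u => x; rewrite -!ideal_piZ ascaleA. Qed.
Fact iq_scale1r : left_id 1 iq_scale.
Proof. by elim/ideal_quotW => x; rewrite -ideal_piZ ascale1r. Qed.
Fact iq_scaleDr : right_distributive iq_scale +%R.
Proof.
move=> k; elim/ideal_quotW => x; elim/ideal_quotW => y.
by rewrite -ideal_piD -!ideal_piZ -ideal_piD ascaleDr.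
Qed.
Fact iq_scaleDl u : {morph iq_scale^~ u : a b / a + b}.
Proof.
move=> a b; elim/ideal_quotW: u => x.
by rewrite -!ideal_piZ -ideal_piD ascaleDl.
Qed.
Fact iq_scaleAl k (u v : ideal_quot X) : iq_scale k (u * v) = iq_scale k u * v.
Proof.
elim/ideal_quotW: u => x; elim/ideal_quotW: v => y.
by rewrite -rmorphM -!ideal_piZ -rmorphM ascaleAl.
Qed.
Fact iq_scaleAr k (u v : ideal_quot X) : iq_scale k (u * v) = u * iq_scale k v.
Proof.
elim/ideal_quotW: u => x; elim/ideal_quotW: v => y.
by rewrite -rmorphM -!ideal_piZ -rmorphM ascaleAr.
Qed.

HB.instance Definition _ := isPzAlgebra.Build K (ideal_quot X)
  iq_scaleA iq_scale1r iq_scaleDr iq_scaleDl iq_scaleAl iq_scaleAr.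

End AlgebraQuotient.

(* Balanced tensor product M (x)_R N: the free abelian group on M * N modulo
   biadditivity and the relations (m r, n) = (m, r n). *)
Section Tensor.
Variables (R : Type) (M N : zmodType) (ra : M -> R -> M) (la : R -> N -> N).

Variant tensor_rel : {malg int[(M * N)%type]} -> Prop :=
| TensorDl m m' n :
    tensor_rel (<< (m + m', n) >> - << (m, n) >> - << (m', n) >>)
| TensorDr m n n' :
    tensor_rel (<< (m, n + n') >> - << (m, n) >> - << (m, n') >>)
| TensorA m r n : tensor_rel (<< (ra m r, n) >> - << (m, la r n) >>).

Definition tensor := {quot (gen_subgroup tensor_rel)}.

HB.instance Definition _ := GRing.Zmodule.on tensor.

Definition tensor_pi (u : {malg int[(M * N)%type]}) : tensor :=
  \pi_({quot (gen_subgroup tensor_rel)}) u.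

Definition tens (m : M) (n : N) : tensor := tensor_pi << (m, n) >>.

Lemma tensor_piP u v :
  reflect (tensor_pi u = tensor_pi v) (u - v \in gen_subgroup tensor_rel).
Proof. by rewrite Quotient.idealrBE; apply: eqP. Qed.

Lemma tensor_pi_reprK (t : tensor) :
  tensor_pi (repr (t : {quot (gen_subgroup tensor_rel)})) = t.
Proof. exact: reprK. Qed.

Lemma tensor_piD : {morph tensor_pi : x y / x + y}.
Proof. by move=> x y; rewrite /tensor_pi !piE. Qed.
Lemma tensor_piB : {morph tensor_pi : x y / x - y}.
Proof. by move=> x y; rewrite /tensor_pi !piE. Qed.
Lemma tensor_pi0 : tensor_pi 0 = 0.
Proof. by rewrite /tensor_pi !piE. Qed.

Lemma tensDl n : {morph tens^~ n : m m' / m + m'}.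
Proof.
move=> m m'; rewrite -tensor_piD; apply/tensor_piP.
by apply: gen_subgroup_sub; rewrite opprD addrA; apply: TensorDl.
Qed.

Lemma tensDr m : {morph tens m : n n' / n + n'}.
Proof.
move=> n n'; rewrite -tensor_piD; apply/tensor_piP.
by apply: gen_subgroup_sub; rewrite opprD addrA; apply: TensorDr.
Qed.

Lemma tensA m r n : tens (ra m r) n = tens m (la r n).
Proof.
by apply/tensor_piP; apply: gen_subgroup_sub; apply: TensorA.
Qed.

Lemma tens0l n : tens 0 n = 0.
Proof. by apply: (addIr (tens 0 n)); rewrite -tensDl !add0r. Qed.
Lemma tens0r m : tens m 0 = 0.
Proof. by apply: (addIr (tens m 0)); rewrite -tensDr !add0r. Qed.
Lemma tensNl m n : tens (- m) n = - tens m n.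
Proof. by apply: (addIr (tens m n)); rewrite -tensDl !addNr tens0l. Qed.
Lemma tensNr m n : tens m (- n) = - tens m n.
Proof. by apply: (addIr (tens m n)); rewrite -tensDr !addNr tens0r. Qed.

Lemma tensor_ind (P : tensor -> Prop) :
  (forall t u, P t -> P u -> P (t + u)) -> (forall m n, P (tens m n)) ->
  forall t, P t.
Proof.
move=> PD PT t; rewrite -[t]tensor_pi_reprK; move: (repr _) => u.
have P0 : P 0 by rewrite -(tens0l 0).
elim/malg_ind: u => [|f g Pf Pg|z [m n]].
- by rewrite tensor_pi0.
- by rewrite tensor_piD; apply: PD.
have PZ k : P (tensor_pi << k%:Z *g (m, n) >>) /\
            P (tensor_pi << - k%:Z *g (m, n) >>).
  elim: k => [|k [IH1 IH2]].
    by rewrite oppr0 monalgU0 tensor_pi0.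
  rewrite -addn1 PoszD opprD !monalgUD !tensor_piD; split; apply: PD => //.
    exact: PT.
  by rewrite monalgUN -[- _]add0r tensor_piB tensor_pi0 add0r -tensNl; exact: PT.
by case: (intP z) => [|k|k]; [case: (PZ 0%N)|case: (PZ k.+1)|case: (PZ k.+1)].
Qed.

Section Lift.
Variables (V : zmodType) (b : M -> N -> V).

Definition balanced : Prop :=
  [/\ forall n, {morph b^~ n : m m' / m + m'},
      forall m, {morph b m : n n' / n + n'} &
      forall m r n, b (ra m r) n = b m (la r n)].

(* The homomorphism [tens m n |-> b m n] when [b] is balanced. *)
Definition tensor_lift (t : tensor) : V :=
  mlift (fun p z => b p.1 p.2 *~ z)
    (repr (t : {quot (gen_subgroup tensor_rel)})).

Hypothesis balb : balanced.

Let FD p : {morph (fun z => b p.1 p.2 *~ z) : x y / x + y}.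
Proof. by move=> x y /=; rewrite mulrzDr. Qed.

Lemma tensor_lift_pi u :
  tensor_lift (tensor_pi u) = mlift (fun p z => b p.1 p.2 *~ z) u.
Proof.
apply/eqP; rewrite -subr_eq0 /tensor_lift -(mliftB FD); apply/eqP.
case: balb => bDl bDr bA.
set w := _ - u; have : w \in gen_subgroup tensor_rel.
  by apply/tensor_piP; rewrite tensor_pi_reprK.
apply: (@gen_subgroup_min _ _ (fun x => mlift _ x = 0)).
  split; first exact: mlift0.
  by move=> x y x0 y0; rewrite (mliftB FD) x0 y0 subr0.
move=> y [m m' n|m n n'|m r n]; rewrite !(mliftB FD) !(mliftU FD)/= !mulr1z.
- by rewrite bDl [b m n + _]addrC addrK subrr.
- by rewrite bDr [b m n + _]addrC addrK subrr.
by rewrite bA subrr.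
Qed.

Lemma tensor_liftD : {morph tensor_lift : t u / t + u}.
Proof.
move=> t u; rewrite -[t]tensor_pi_reprK -[u]tensor_pi_reprK -tensor_piD.
by rewrite !tensor_lift_pi (mliftD FD).
Qed.

Lemma tensor_liftE m n : tensor_lift (tens m n) = b m n.
Proof. by rewrite tensor_lift_pi (mliftU FD) mulr1z. Qed.

End Lift.

End Tensor.

Section TensorAlgebra.
Variables (K : comPzRingType) (A B : pzAlgType K).

Definition tensor_alg :=
  @tensor K A B (fun a k => ascale k a) (fun k b => ascale k b).

HB.instance Definition _ := GRing.Zmodule.on tensor_alg.

Local Notation "u ⊗ v" :=
  (@tens K A B (fun a k => ascale k a) (fun k b => ascale k b) u v : tensor_alg)
  (at level 39).

Definition talg_one : tensor_alg := 1 ⊗ 1.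

(* The product with (a (x) b) (a' (x) b') = a a' (x) b b'. *)
Definition talg_mul (u v : tensor_alg) : tensor_alg :=
  tensor_lift (fun a b => tensor_lift (fun a' b' => (a * a') ⊗ (b * b')) v) u.

Definition talg_scale (k : K) (u : tensor_alg) : tensor_alg :=
  tensor_lift (fun a b => ascale k a ⊗ b) u.

Let bal1 (a : A) (b : B) :
  balanced (fun a k => ascale k a) (fun k b => ascale k b)
    (fun a' b' => (a * a') ⊗ (b * b')).
Proof.
split=> [n m m'|m n n'|m r n].
- by rewrite mulrDr tensDl.
- by rewrite mulrDr tensDr.
by rewrite -!ascaleAr tensA.
Qed.

Lemma talg_lift1E a b a' b' :
  tensor_lift (fun a' b' => (a * a') ⊗ (b * b')) (a' ⊗ b')
    = (a * a') ⊗ (b * b').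
Proof. exact: (tensor_liftE (bal1 a b)). Qed.

Let bal2 (v : tensor_alg) :
  balanced (fun a k => ascale k a) (fun k b => ascale k b)
    (fun a b => tensor_lift (fun a' b' => (a * a') ⊗ (b * b')) v : tensor_alg).
Proof.
split=> [n m m'|m n n'|m r n].
- elim/tensor_ind: v => [t u Et Eu|a b].
    by rewrite !(tensor_liftD (bal1 _ _)) Et Eu addrACA.
  by rewrite !(tensor_liftE (bal1 _ _)) mulrDl tensDl.
- elim/tensor_ind: v => [t u Et Eu|a b].
    by rewrite !(tensor_liftD (bal1 _ _)) Et Eu addrACA.
  by rewrite !(tensor_liftE (bal1 _ _)) mulrDl tensDr.
elim/tensor_ind: v => [t u Et Eu|a b].
  by rewrite !(tensor_liftD (bal1 _ _)) Et Eu.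
by rewrite !(tensor_liftE (bal1 _ _)) -!ascaleAl tensA.
Qed.

Let bal3 (k : K) :
  balanced (fun a k => ascale k a) (fun k b => ascale k b)
    (fun a b => ascale k a ⊗ b).
Proof.
split=> [n m m'|m n n'|m r n].
- by rewrite ascaleDr tensDl.
- by rewrite tensDr.
by rewrite -tensA !ascaleA mulrC.
Qed.

Lemma talg_mulE a b a' b' :
  talg_mul (a ⊗ b) (a' ⊗ b') = (a * a') ⊗ (b * b').
Proof. by rewrite /talg_mul (tensor_liftE (bal2 _)) (tensor_liftE (bal1 _ _)). Qed.

Lemma talg_mulDl : left_distributive talg_mul +%R.
Proof. by move=> u v w; rewrite /talg_mul (tensor_liftD (bal2 _)). Qed.

Lemma talg_mulDr : right_distributive talg_mul +%R.
Proof.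
move=> u v w; elim/tensor_ind: u => [t u Et Eu|a b].
  by rewrite !talg_mulDl Et Eu addrACA.
by rewrite /talg_mul !(tensor_liftE (bal2 _)) (tensor_liftD (bal1 _ _)).
Qed.

Lemma talg_mulA : associative talg_mul.
Proof.
move=> u v w; elim/tensor_ind: u => [t u Et Eu|a b].
  by rewrite !talg_mulDl Et Eu.
elim/tensor_ind: v => [t v Et Ev|a' b'].
  by rewrite !(talg_mulDr, talg_mulDl) Et Ev.
elim/tensor_ind: w => [t w Et Ew|a'' b''].
  by rewrite !talg_mulDr Et Ew.
by rewrite !talg_mulE !mulrA.
Qed.

Lemma talg_mul1r : left_id talg_one talg_mul.
Proof.
elim/tensor_ind => [t u Et Eu|a b]; first by rewrite talg_mulDr Et Eu.
by rewrite talg_mulE !mul1r.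
Qed.

Lemma talg_mulr1 : right_id talg_one talg_mul.
Proof.
elim/tensor_ind => [t u Et Eu|a b]; first by rewrite talg_mulDl Et Eu.
by rewrite talg_mulE !mulr1.
Qed.

HB.instance Definition _ := GRing.Zmodule_isPzRing.Build tensor_alg
  talg_mulA talg_mul1r talg_mulr1 talg_mulDl talg_mulDr.

Lemma talg_scaleE k a b : talg_scale k (a ⊗ b) = ascale k a ⊗ b.
Proof. exact: (tensor_liftE (bal3 k)). Qed.

Lemma talg_scaleDr : right_distributive talg_scale +%R.
Proof. by move=> k u v; rewrite /talg_scale (tensor_liftD (bal3 k)). Qed.

Lemma talg_scaleDl u : {morph talg_scale^~ u : k l / k + l}.
Proof.
move=> k l; elim/tensor_ind: u => [t u Et Eu|a b].
  by rewrite !talg_scaleDr Et Eu addrACA.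
by rewrite !talg_scaleE ascaleDl tensDl.
Qed.

Lemma talg_scaleA k l u : talg_scale k (talg_scale l u) = talg_scale (k * l) u.
Proof.
elim/tensor_ind: u => [t u Et Eu|a b]; first by rewrite !talg_scaleDr Et Eu.
by rewrite !talg_scaleE ascaleA.
Qed.

Lemma talg_scale1r : left_id 1 talg_scale.
Proof.
elim/tensor_ind => [t u Et Eu|a b]; first by rewrite talg_scaleDr Et Eu.
by rewrite talg_scaleE ascale1r.
Qed.

Lemma talg_scaleAl k (u v : tensor_alg) :
  talg_scale k (u * v) = talg_scale k u * v.
Proof.
elim/tensor_ind: u => [t u Et Eu|a b].
  by rewrite mulrDl !talg_scaleDr mulrDl Et Eu.
elim/tensor_ind: v => [t v Et Ev|a' b'].
  by rewrite !mulrDr talg_scaleDr Et Ev.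
by rewrite talg_scaleE [_ * _]talg_mulE [RHS]talg_mulE talg_scaleE ascaleAl.
Qed.

Lemma talg_scaleAr k (u v : tensor_alg) :
  talg_scale k (u * v) = u * talg_scale k v.
Proof.
elim/tensor_ind: u => [t u Et Eu|a b].
  by rewrite !mulrDl talg_scaleDr Et Eu.
elim/tensor_ind: v => [t v Et Ev|a' b'].
  by rewrite mulrDr !talg_scaleDr mulrDr Et Ev.
by rewrite talg_scaleE [_ * _]talg_mulE [RHS]talg_mulE talg_scaleE ascaleAr.
Qed.

HB.instance Definition _ := isPzAlgebra.Build K tensor_alg
  talg_scaleA talg_scale1r talg_scaleDr talg_scaleDl talg_scaleAl talg_scaleAr.

End TensorAlgebra.

HB.mixin Record isAlgScalable (K : pzRingType) (A R : pzAlgType K)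
    (f : A -> R) := {
  amorphZ : forall k, {morph f : a / ascale k a}
}.

HB.structure Definition PzAlgMorphism (K : pzRingType) (A R : pzAlgType K) :=
  {f of @GRing.RMorphism A R f & isAlgScalable K A R f}.

Notation "{ 'amorphism' A -> R }" := (PzAlgMorphism.type A R)
  (at level 0, A at level 98, R at level 99,
   format "{ 'amorphism'  A  ->  R }") : type_scope.

HB.instance Definition _ (K : pzRingType) (R : pzAlgType K) (X : R -> Prop) :=
  isAlgScalable.Build K R (ideal_quot X) (ideal_pi X) (ideal_piZ X).

(* The enveloping algebra of R over K; [R^c] is the opposite algebra. *)
Definition env (K : comPzRingType) (R : pzAlgType K) := tensor_alg R R^c.

Section Enveloping.
Variables (K : comPzRingType).

HB.instance Definition _ (R : pzAlgType K) := PzAlgebra.on (env R).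

Definition etens (R : pzAlgType K) (x y : R) : env R :=
  @tens K R R^c (fun a k => ascale k a) (fun k b => ascale k b) x y.

Lemma etensM (R : pzAlgType K) (x y x' y' : R) :
  etens x y * etens x' y' = etens (x * x') (y' * y).
Proof. exact: (@talg_mulE K R R^c). Qed.

Lemma env_ind (R : pzAlgType K) (P : env R -> Prop) :
  (forall t u, P t -> P u -> P (t + u)) -> (forall x y, P (etens x y)) ->
  forall t, P t.
Proof. exact: tensor_ind. Qed.

Section Functoriality.
Variables (A R : pzAlgType K) (f : {amorphism A -> R}).

(* The map (a (x) b) |-> (f a (x) f b). *)
Definition env_map (u : env A) : env R :=
  tensor_lift (fun a b => etens (f a) (f b)) u.

Let balf : balanced (fun (a : A) (k : K) => ascale k a)
  (fun (k : K) (b : A^c) => ascale k b) (fun a b => etens (f a) (f b)).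
Proof.
split=> [n m m'|m n n'|m r n].
- by rewrite rmorphD /etens tensDl.
- by rewrite [f (n + n')]rmorphD /etens tensDr.
by rewrite !amorphZ /etens tensA.
Qed.

Lemma env_mapE a b : env_map (etens a b) = etens (f a) (f b).
Proof. exact: (tensor_liftE balf). Qed.

Let env_mapD : {morph env_map : u v / u + v}.
Proof. exact: (tensor_liftD balf). Qed.

Lemma env_map_is_zmod_morphism : zmod_morphism env_map.
Proof.
have N0 : env_map 0 = 0 by apply: (addIr (env_map 0)); rewrite -env_mapD !add0r.
move=> u v; rewrite env_mapD; congr (_ + _).
by apply: (addIr (env_map v)); rewrite -env_mapD !addNr N0.
Qed.

Lemma env_map_is_monoid_morphism : monoid_morphism env_map.
Proof.
split; first by rewrite [LHS]env_mapE rmorph1.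
move=> u v; elim/env_ind: u => [t u Et Eu|a b].
  by rewrite mulrDl !env_mapD mulrDl Et Eu.
elim/env_ind: v => [t v Et Ev|a' b'].
  by rewrite mulrDr !env_mapD mulrDr Et Ev.
by rewrite etensM !env_mapE etensM !rmorphM.
Qed.

HB.instance Definition _ :=
  GRing.isZmodMorphism.Build (env A) (env R) env_map env_map_is_zmod_morphism.
HB.instance Definition _ :=
  GRing.isMonoidMorphism.Build (env A) (env R) env_map
    env_map_is_monoid_morphism.

End Functoriality.
End Enveloping.

(* T as a left, resp. right, R-module through f.  A right R-module is a left
   module over the converse ring [R^c], so that [(r : R^c) *: x] is x r. *)
Definition lrestr (R T : pzRingType) (f : {rmorphism R -> T}) : Type := T.
Definition rrestr (R T : pzRingType) (f : {rmorphism R -> T}) : Type := T.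

Section RestrictionOfScalars.
Variables (R T : pzRingType) (f : {rmorphism R -> T}).

HB.instance Definition _ := GRing.Zmodule.on (lrestr f).
HB.instance Definition _ := GRing.Zmodule.on (rrestr f).

Definition lrestr_scale (r : R) (x : lrestr f) : lrestr f := f r * (x : T).
Definition rrestr_scale (r : R^c) (x : rrestr f) : rrestr f :=
  (x : T) * f (r : R).

Fact lrestr_scaleA a b x :
  lrestr_scale a (lrestr_scale b x) = lrestr_scale (a * b) x.
Proof. by rewrite /lrestr_scale rmorphM mulrA. Qed.
Fact lrestr_scale1r : left_id 1 lrestr_scale.
Proof. by move=> x; rewrite /lrestr_scale rmorph1 mul1r. Qed.
Fact lrestr_scaleDr : right_distributive lrestr_scale +%R.
Proof. by move=> a x y; rewrite /lrestr_scale [LHS]mulrDr. Qed.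
Fact lrestr_scaleDl x : {morph lrestr_scale^~ x : a b / a + b}.
Proof. by move=> a b; rewrite /lrestr_scale rmorphD [LHS]mulrDl. Qed.

HB.instance Definition _ := GRing.Zmodule_isLmodule.Build R (lrestr f)
  lrestr_scaleA lrestr_scale1r lrestr_scaleDr lrestr_scaleDl.

Fact rrestr_scaleA a b x :
  rrestr_scale a (rrestr_scale b x) = rrestr_scale (a * b) x.
Proof. by rewrite /rrestr_scale [f (a * b : R^c)]rmorphM mulrA. Qed.
Fact rrestr_scale1r : left_id 1 rrestr_scale.
Proof. by move=> x; rewrite /rrestr_scale [f _]rmorph1 mulr1. Qed.
Fact rrestr_scaleDr : right_distributive rrestr_scale +%R.
Proof. by move=> a x y; rewrite /rrestr_scale [LHS]mulrDl. Qed.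
Fact rrestr_scaleDl x : {morph rrestr_scale^~ x : a b / a + b}.
Proof. by move=> a b; rewrite /rrestr_scale [f _]rmorphD [LHS]mulrDr. Qed.

HB.instance Definition _ := GRing.Zmodule_isLmodule.Build R^c (rrestr f)
  rrestr_scaleA rrestr_scale1r rrestr_scaleDr rrestr_scaleDl.

End RestrictionOfScalars.

Section Flatness.
Variable R : pzRingType.

(* M (x)_R N for a right R-module M and a left R-module N. *)
Definition tensor_mod (M : lmodType R^c) (N : lmodType R) :=
  @tensor R M N (fun m r => (r : R^c) *: m) (fun r n => r *: n).

HB.instance Definition _ M N := GRing.Zmodule.on (tensor_mod M N).

Definition mtens (M : lmodType R^c) (N : lmodType R) (m : M) (n : N) :
    tensor_mod M N :=
  @tens R M N (fun m r => (r : R^c) *: m) (fun r n => r *: n) m n.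

Definition tensor_mapl (M M' : lmodType R^c) (N : lmodType R)
    (f : {linear M -> M'}) : tensor_mod M N -> tensor_mod M' N :=
  tensor_lift (fun m n => mtens (f m) n).

Definition tensor_mapr (M : lmodType R^c) (N N' : lmodType R)
    (f : {linear N -> N'}) : tensor_mod M N -> tensor_mod M N' :=
  tensor_lift (fun m n => mtens m (f n)).

Lemma tensor_mapl_balanced (M M' : lmodType R^c) (N : lmodType R)
    (f : {linear M -> M'}) :
  balanced (fun (m : M) (r : R) => (r : R^c) *: m)
    (fun (r : R) (n : N) => r *: n) (fun m n => mtens (f m) n).
Proof.
split=> [n m m'|m n n'|m r n].
- by rewrite linearD /mtens tensDl.
- by rewrite /mtens tensDr.
by rewrite linearZ /mtens tensA.
Qed.

Lemma tensor_mapr_balanced (M : lmodType R^c) (N N' : lmodType R)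
    (f : {linear N -> N'}) :
  balanced (fun (m : M) (r : R) => (r : R^c) *: m)
    (fun (r : R) (n : N) => r *: n) (fun m n => mtens m (f n)).
Proof.
split=> [n m m'|m n n'|m r n].
- by rewrite /mtens tensDl.
- by rewrite linearD /mtens tensDr.
by rewrite linearZ /mtens tensA.
Qed.

Lemma tensor_maplE (M M' : lmodType R^c) (N : lmodType R)
    (f : {linear M -> M'}) m (n : N) :
  tensor_mapl f (mtens m n) = mtens (f m) n.
Proof. exact: (tensor_liftE (tensor_mapl_balanced N f)). Qed.

Lemma tensor_maprE (M : lmodType R^c) (N N' : lmodType R)
    (f : {linear N -> N'}) (m : M) n :
  tensor_mapr f (mtens m n) = mtens m (f n).
Proof. exact: (tensor_liftE (tensor_mapr_balanced M f)). Qed.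

Definition lflat (N : lmodType R) : Prop :=
  forall (M M' : lmodType R^c) (f : {linear M -> M'}),
    injective f -> injective (@tensor_mapl M M' N f).

Definition rflat (M : lmodType R^c) : Prop :=
  forall (N N' : lmodType R) (f : {linear N -> N'}),
    injective f -> injective (@tensor_mapr M N N' f).

End Flatness.

Section EnvModule.
Variables (K : comPzRingType) (A R : pzAlgType K) (f : {amorphism A -> R}).

(* R^e as a left and as a right A^e-module through f: A -> R. *)
Definition env_lmod := lrestr (env_map f).
Definition env_rmod := rrestr (env_map f).

HB.instance Definition _ := GRing.Lmodule.on env_lmod.
HB.instance Definition _ := GRing.Lmodule.on env_rmod.

Lemma env_lmodE (a b : A) (x y : R) :
  etens a b *: (etens x y : env_lmod) = etens (f a * x) (y * f b).
Proof. by rewrite -etensM -env_mapE. Qed.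

Lemma env_rmodE (a b : A) (x y : R) :
  (etens a b : (env A)^c) *: (etens x y : env_rmod) = etens (x * f a) (f b * y).
Proof. by rewrite -etensM -env_mapE. Qed.

End EnvModule.

HB.mixin Record Monoid_isInverseMonoid S of Monoid S := {
  iinv : S -> S;
  mulg_iinvK : forall s : S, (s * iinv s * s = s)%g;
  iinv_mulgK : forall s : S, (iinv s * s * iinv s = iinv s)%g;
  iinv_uniq : forall s t : S,
    (s * t * s = s)%g -> (t * s * t = t)%g -> t = iinv s
}.

#[short(type="invMonoidType")]
HB.structure Definition InverseMonoid :=
  {S of Monoid_isInverseMonoid S & Monoid S}.

Section InverseMonoids.
Variable S : invMonoidType.
Implicit Types e s t : S.

Definition idempotent_elt e : Prop := (e * e = e)%g.

Definition natural_le s t : Prop := exists2 e, idempotent_elt e & (s = e * t)%g.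

Definition E_unitary : Prop :=
  forall e s, idempotent_elt e -> natural_le e s -> idempotent_elt s.

End InverseMonoids.

(* Elements of the symmetric inverse monoid I(X): bijections between subsets of
   X, encoded as injective partial maps. *)
Record partial_bij (X : Type) := PartialBij {
  pfun :> X -> option X;
  pfun_inj : forall x y z, pfun x = Some z -> pfun y = Some z -> x = y
}.

Section PartialBijections.
Variable X : Type.
Implicit Types f g : partial_bij X.

Definition pdom f (x : X) : Prop := exists y, f x = Some y.
Definition pran f (y : X) : Prop := exists x, f x = Some y.

Fact pmul_inj f g x y z :
  obind f (g x) = Some z -> obind f (g y) = Some z -> x = y.
Proof.
case Ex: (g x) => [x'|//]; case Ey: (g y) => [y'|//] /= fx fy.
by apply: (pfun_inj Ex); rewrite Ey (pfun_inj fx fy).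
Qed.

Definition pmul f g := PartialBij (@pmul_inj f g).

End PartialBijections.

Record unital_action (K : comPzRingType) (A : pzAlgType K)
    (S : invMonoidType) := UnitalAction {
  act :> S -> partial_bij A;
  act_mul : forall s t, act (s * t)%g =1 pmul (act s) (act t);
  act_one : act 1%g =1 Some;
  act_dom_ideal : forall s, is_ideal (pdom (act s));
  act_ran_ideal : forall s, is_ideal (pran (act s));
  actD : forall s x x' y y',
    act s x = Some x' -> act s y = Some y' -> act s (x + y) = Some (x' + y');
  actM : forall s x x' y y',
    act s x = Some x' -> act s y = Some y' -> act s (x * y) = Some (x' * y');
  actZ : forall s (k : K) x x',
    act s x = Some x' -> act s (ascale k x) = Some (ascale k x');
  (* 1_s, determined by the range of act s by act_ran *)
  act_unit : S -> A;
  act_unit_idem : forall s, act_unit s * act_unit s = act_unit s;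
  act_unit_central : forall s a, act_unit s * a = a * act_unit s;
  act_ran : forall s y, pran (act s) y <-> exists a, y = act_unit s * a
}.

Section CrossedProduct.
Variables (K : comPzRingType) (A : pzAlgType K) (S : invMonoidType).
Variable theta : unital_action A S.
Implicit Types (s t : S) (a b x y : A).

Local Notation "'u_ s" := (act_unit theta s) (at level 3, s at level 2).

Lemma act_domE s x : pdom (theta s) x <-> exists a, x = 'u_(iinv s) * a.
Proof.
rewrite -act_ran; split=> [[y sx]|[y sy]].
  exists y; have := act_mul theta (s * iinv s)%g s x.
  rewrite mulg_iinvK sx /= sx /= (act_mul theta s _ y) /=.
  case E: (theta (iinv s) y) => [z|//] /= /esym Ez.
  by rewrite (pfun_inj Ez sx).
have := act_mul theta (iinv s * s)%g (iinv s) y.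
rewrite iinv_mulgK sy /= sy /= (act_mul theta _ s x) /=.
by case E: (theta s x) => [z|//] _; exists z.
Qed.

Lemma act_unitP s x : (exists a, x = 'u_s * a) <-> 'u_s * x = x.
Proof.
split=> [[a ->]|<-]; first by rewrite mulrA act_unit_idem.
by exists x.
Qed.

(* b |-> theta_s (1_{s^-1} b) *)
Definition act_ext s b : A := odflt 0 (theta s ('u_(iinv s) * b)).

Lemma act_extE s b : theta s ('u_(iinv s) * b) = Some (act_ext s b).
Proof.
have [y sy] : pdom (theta s) ('u_(iinv s) * b) by apply/act_domE; exists b.
by rewrite /act_ext sy.
Qed.

Lemma act_ext_unit s b : 'u_s * act_ext s b = act_ext s b.
Proof.
by apply/act_unitP/act_ran; exists ('u_(iinv s) * b); exact: act_extE.
Qed.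

Lemma act_ext_dom s x y : theta s x = Some y -> act_ext s x = y.
Proof.
move=> sx; have /act_domE/act_unitP : pdom (theta s) x by exists y.
by rewrite /act_ext => ->; rewrite sx.
Qed.

Lemma act_extD s : {morph act_ext s : a b / a + b}.
Proof.
move=> a b; apply: Some_inj; rewrite -act_extE mulrDr.
by apply: actD; exact: act_extE.
Qed.

Lemma act_extM s : {morph act_ext s : a b / a * b}.
Proof.
move=> a b; apply: Some_inj; rewrite -act_extE.
have -> : 'u_(iinv s) * (a * b) = ('u_(iinv s) * a) * ('u_(iinv s) * b).
  by rewrite -mulrA [a * ('u_ _ * b)]mulrA -(act_unit_central theta _ a) !mulrA
     act_unit_idem.
by apply: actM; exact: act_extE.
Qed.

Lemma act_extZ s k a : act_ext s (ascale k a) = ascale k (act_ext s a).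
Proof.
apply: Some_inj; rewrite -act_extE -ascaleAr; apply: actZ; exact: act_extE.
Qed.

Lemma act_ext_unitr s : act_ext s 1 = 'u_s.
Proof.
have [x sx] : pran (theta s) 'u_s by apply/act_ran; exists 1; rewrite mulr1.
rewrite -[LHS]act_ext_unit act_unit_central -(act_ext_dom sx) -act_extM.
by rewrite mul1r.
Qed.

Lemma act_ext_mul s t b : act_ext (s * t)%g b = act_ext s (act_ext t b).
Proof.
pose e := 'u_(iinv (s * t)%g).
have key c : exists z, [/\ z = act_ext t (e * c), 'u_(iinv s) * z = z &
    theta s z = Some (act_ext (s * t)%g c)].
  have := act_extE (s * t)%g c; rewrite act_mul /=.
  case E: (theta t _) => [z|//] /= sz; exists z; split=> //.
    by rewrite (act_ext_dom E).
  by apply/act_unitP/act_domE; eexists; exact: sz.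
have te : act_ext t e = 'u_(iinv s) * 'u_t.
  have [_ [-> + _]] := key 1; rewrite mulr1 => se.
  have [y ty] : pran (theta t) ('u_(iinv s) * 'u_t).
    by apply/act_ran; exists 'u_(iinv s); rewrite act_unit_central.
  have /act_domE/act_unitP ey : pdom (theta (s * t)%g) y.
    rewrite /pdom act_mul /= ty /=.
    by apply/act_domE; exists 'u_t.
  rewrite -[RHS](act_ext_dom ty) -[in RHS]ey -/e act_extM (act_ext_dom ty).
  by rewrite mulrA -(act_unit_central theta _ (act_ext t e)) se
     -act_unit_central act_ext_unit.
have [z [Ez _ tz]] := key b; apply: Some_inj.
rewrite -tz -(act_extE s) Ez; congr (theta s _).
by rewrite act_extM te -mulrA act_ext_unit.
Qed.

Lemma act_unit1 : 'u_1%g = 1.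
Proof.
have /act_ran/act_unitP : pran (theta 1%g) 1 by exists 1; rewrite act_one.
by rewrite mulr1.
Qed.

Lemma act_ext1 b : act_ext 1%g b = b.
Proof. by apply: act_ext_dom; rewrite act_one. Qed.

Lemma act_unit_mul s t : 'u_(s * t)%g = act_ext s 'u_t.
Proof. by rewrite -!act_ext_unitr act_ext_mul. Qed.

Lemma act_ext_idem e b : idempotent_elt e -> act_ext e b = 'u_e * b.
Proof.
move=> ee; have idE c : act_ext e c = 'u_(iinv e) * c.
  apply: (@pfun_inj _ (theta e) _ _ (act_ext e c)); last exact: act_extE.
  by have := act_mul theta e e ('u_(iinv e) * c); rewrite /= ee act_extE /= => <-.
by rewrite idE -(act_ext_unitr e) idE mulr1.
Qed.

(* 1_s A is contained in 1_t A when s <= t, so that a delta_t below makes sense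
   for a in 1_s A. *)
Lemma act_unit_le s t a : natural_le s t -> 'u_s * a = a -> 'u_t * a = a.
Proof.
move=> [e ee ->]; rewrite act_unit_mul act_ext_idem// => <-.
by rewrite mulrA; congr (_ * _);
  rewrite mulrA (act_unit_central theta t) -mulrA act_unit_idem.
Qed.

(* L(A, theta, S): the finitely supported families (a_s) with a_s in 1_s A; the
   family concentrated in s with value a is [<< a *g s >>], for a delta_s. *)
Definition in_skew : {pred {malg A[S]}} :=
  [pred f : {malg A[S]} | `[< forall s, exists a, f@_s = 'u_s * a >]].

Lemma in_skewP (f : {malg A[S]}) :
  reflect (forall s, 'u_s * f@_s = f@_s) (f \in in_skew).
Proof.
rewrite inE; apply: (iffP (asboolP _)) => fP s; first exact/act_unitP.
by apply/act_unitP; exact: fP.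
Qed.

Lemma in_skew_closed : zmod_closed in_skew.
Proof.
split; first by apply/in_skewP => s; rewrite mcoeff0 mulr0.
move=> f g /in_skewP fP /in_skewP gP; apply/in_skewP => s.
by rewrite mcoeffB mulrBr fP gP.
Qed.

HB.instance Definition _ :=
  GRing.isZmodClosed.Build {malg A[S]} in_skew in_skew_closed.

Lemma in_skewU a s : 'u_s * a = a -> << a *g s >> \in in_skew.
Proof.
move=> ua; apply/in_skewP => t; rewrite mcoeffU.
by case: eqP => [<-|_]; rewrite ?mulr1n ?mulr0n ?mulr0.
Qed.

Record skew := Skew { skew_val :> {malg A[S]}; skewP : skew_val \in in_skew }.

HB.instance Definition _ := [isSub for skew_val].
HB.instance Definition _ := [Choice of skew by <:].
HB.instance Definition _ := [SubChoice_isSubZmodule of skew by <:].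

Lemma skew_val_inj : injective skew_val.
Proof. exact: val_inj. Qed.
Lemma skew_valD (f g : skew) : skew_val (f + g) = skew_val f + skew_val g.
Proof. by []. Qed.

(* (a delta_s) (b delta_t) = a theta_s (1_{s^-1} b) delta_{st} *)
Definition malg_skew_mul (f g : {malg A[S]}) : {malg A[S]} :=
  \sum_(s <- msupp f) \sum_(t <- msupp g)
    << f@_s * act_ext s g@_t *g (s * t)%g >>.

Definition malg_skew_scale (k : K) (f : {malg A[S]}) : {malg A[S]} :=
  \sum_(s <- msupp f) << ascale k f@_s *g s >>.

Local Notation "f ∘ g" := (malg_skew_mul f g) (at level 40, left associativity).

Let lin1 s a t : {morph (fun b => << a * act_ext s b *g (s * t)%g >>
  : {malg A[S]}) : x y / x + y}.
Proof. by move=> x y /=; rewrite act_extD mulrDr monalgUD. Qed.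

Let lin2 (g : {malg A[S]}) s : {morph (fun a => mlift
    (fun t b => << a * act_ext s b *g (s * t)%g >> : {malg A[S]}) g)
  : x y / x + y}.
Proof.
move=> x y /=; rewrite -mliftDF; apply: eq_mlift => t b.
by rewrite mulrDl monalgUD.
Qed.

Let lin3 k s : {morph (fun a => << ascale k a *g s >> : {malg A[S]})
  : x y / x + y}.
Proof. by move=> x y /=; rewrite ascaleDr monalgUD. Qed.

Let mulE (f g : {malg A[S]}) : f ∘ g = mlift (fun s a => mlift
    (fun t b => << a * act_ext s b *g (s * t)%g >> : {malg A[S]}) g) f.
Proof. by []. Qed.

Lemma malg_skew_mulU a s b t :
  << a *g s >> ∘ << b *g t >> = << a * act_ext s b *g (s * t)%g >>.
Proof. by rewrite mulE (mliftU (lin2 _)) (mliftU (lin1 _ _)). Qed.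

Lemma malg_skew_mulDl : left_distributive malg_skew_mul +%R.
Proof. by move=> f g h; rewrite !mulE (mliftD (lin2 _)). Qed.

Lemma malg_skew_mulDr : right_distributive malg_skew_mul +%R.
Proof.
move=> f g h; rewrite !mulE -mliftDF; apply: eq_mlift => s a.
by rewrite (mliftD (lin1 _ _)).
Qed.

Lemma malg_skew_mul0l f : 0 ∘ f = 0.
Proof. by rewrite mulE mlift0. Qed.
Lemma malg_skew_mul0r f : f ∘ 0 = 0.
Proof. by apply: (addIr (f ∘ 0)); rewrite -malg_skew_mulDr !add0r. Qed.

Lemma malg_skew_mulA : associative malg_skew_mul.
Proof.
move=> f g h; elim/malg_ind: f => [|f f' Ef Ef'|a s].
- by rewrite !malg_skew_mul0l.
- by rewrite !malg_skew_mulDl Ef Ef'.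
elim/malg_ind: g => [|g g' Eg Eg'|b t].
- by rewrite !(malg_skew_mul0l, malg_skew_mul0r).
- by rewrite !(malg_skew_mulDl, malg_skew_mulDr) Eg Eg'.
elim/malg_ind: h => [|h h' Eh Eh'|c r].
- by rewrite !malg_skew_mul0r.
- by rewrite !malg_skew_mulDr Eh Eh'.
by rewrite !malg_skew_mulU act_extM act_ext_mul !mulrA mulgA.
Qed.

Lemma malg_skew_mul1f f : << 1 *g 1%g >> ∘ f = f.
Proof.
elim/malg_ind: f => [|f f' Ef Ef'|a s].
- by rewrite malg_skew_mul0r.
- by rewrite malg_skew_mulDr Ef Ef'.
by rewrite malg_skew_mulU mul1r mul1g act_ext1.
Qed.

Lemma malg_skew_mulf1 f : f \in in_skew -> f ∘ << 1 *g 1%g >> = f.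
Proof.
move=> /in_skewP fP; rewrite mulE [RHS]monalgE; apply: eq_bigr => s _.
by rewrite (mliftU (lin1 _ _)) act_ext_unitr mulg1 -act_unit_central fP.
Qed.

Lemma malg_skew_mul_in f g : g \in in_skew -> f ∘ g \in in_skew.
Proof.
move=> /in_skewP gP; apply: rpred_sum => s _; apply: rpred_sum => t _.
apply: in_skewU; rewrite -[g@_t]gP act_extM -act_unit_mul.
move: (act_ext s g@_t) => x.
by rewrite mulrA act_unit_central -mulrA (mulrA 'u_(_) _ x) act_unit_idem.
Qed.

Lemma malg_skew_scaleU k a s :
  malg_skew_scale k << a *g s >> = << ascale k a *g s >>.
Proof. exact: (mliftU (lin3 k)). Qed.

Lemma malg_skew_scaleDr : right_distributive malg_skew_scale +%R.
Proof. by move=> k f g; apply: (mliftD (lin3 k)). Qed.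

Lemma malg_skew_scale0 k : malg_skew_scale k 0 = 0.
Proof. exact: (mlift0 (fun s a => << ascale k a *g s >>)). Qed.

Lemma malg_skew_scale_in k f : f \in in_skew -> malg_skew_scale k f \in in_skew.
Proof.
move=> /in_skewP fP; apply: rpred_sum => s _; apply: in_skewU.
by rewrite -ascaleAr fP.
Qed.

Definition skew_one : skew :=
  Skew (in_skewU (etrans (mulr1 'u_1%g) act_unit1)).
Definition skew_mul (f g : skew) : skew :=
  Skew (malg_skew_mul_in f (skewP g)).
Definition skew_scale k (f : skew) : skew :=
  Skew (malg_skew_scale_in k (skewP f)).

Fact skew_mulA : associative skew_mul.
Proof. by move=> f g h; apply/val_inj/malg_skew_mulA. Qed.
Fact skew_mul1r : left_id skew_one skew_mul.
Proof. by move=> f; apply/val_inj/malg_skew_mul1f. Qed.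
Fact skew_mulr1 : right_id skew_one skew_mul.
Proof. by move=> f; apply/val_inj/malg_skew_mulf1/skewP. Qed.
Fact skew_mulDl : left_distributive skew_mul +%R.
Proof. by move=> f g h; apply/val_inj/malg_skew_mulDl. Qed.
Fact skew_mulDr : right_distributive skew_mul +%R.
Proof. by move=> f g h; apply/val_inj/malg_skew_mulDr. Qed.

HB.instance Definition _ := GRing.Zmodule_isPzRing.Build skew
  skew_mulA skew_mul1r skew_mulr1 skew_mulDl skew_mulDr.

Fact skew_scaleA k l f : skew_scale k (skew_scale l f) = skew_scale (k * l) f.
Proof.
apply: val_inj => /=; elim/malg_ind: (skew_val f) => [|g h Eg Eh|a s].
- by rewrite !malg_skew_scale0.
- by rewrite !malg_skew_scaleDr Eg Eh.
by rewrite !malg_skew_scaleU ascaleA.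
Qed.
Fact skew_scale1r : left_id 1 skew_scale.
Proof.
move=> f; apply: val_inj => /=; elim/malg_ind: (skew_val f) => [|g h Eg Eh|a s].
- by rewrite !malg_skew_scale0.
- by rewrite !malg_skew_scaleDr Eg Eh.
by rewrite !malg_skew_scaleU ascale1r.
Qed.
Fact skew_scaleDr : right_distributive skew_scale +%R.
Proof. by move=> k f g; apply/val_inj/malg_skew_scaleDr. Qed.
Fact skew_scaleDl f : {morph skew_scale^~ f : k l / k + l}.
Proof.
move=> k l; apply: val_inj => /=.
elim/malg_ind: (skew_val f) => [|g h Eg Eh|a s].
- by rewrite !malg_skew_scale0 addr0.
- by rewrite !malg_skew_scaleDr Eg Eh addrACA.
by rewrite !malg_skew_scaleU ascaleDl monalgUD.
Qed.
Fact skew_scaleAl k (f g : skew) : skew_scale k (f * g) = skew_scale k f * g.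
Proof.
apply: val_inj => /=; elim/malg_ind: (skew_val f) => [|f1 f2 E1 E2|a s].
- by rewrite malg_skew_mul0l malg_skew_scale0 malg_skew_mul0l.
- by rewrite !(malg_skew_mulDl, malg_skew_scaleDr) E1 E2.
elim/malg_ind: (skew_val g) => [|f1 f2 E1 E2|b t].
- by rewrite !malg_skew_mul0r malg_skew_scale0.
- by rewrite !malg_skew_mulDr malg_skew_scaleDr E1 E2.
by rewrite !(malg_skew_mulU, malg_skew_scaleU) ascaleAl.
Qed.
Fact skew_scaleAr k (f g : skew) : skew_scale k (f * g) = f * skew_scale k g.
Proof.
apply: val_inj => /=; elim/malg_ind: (skew_val f) => [|f1 f2 E1 E2|a s].
- by rewrite !malg_skew_mul0l malg_skew_scale0.
- by rewrite !malg_skew_mulDl malg_skew_scaleDr E1 E2.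
elim/malg_ind: (skew_val g) => [|f1 f2 E1 E2|b t].
- by rewrite !(malg_skew_mul0r, malg_skew_scale0).
- by rewrite !(malg_skew_mulDr, malg_skew_scaleDr) E1 E2.
by rewrite !(malg_skew_mulU, malg_skew_scaleU) act_extZ ascaleAr.
Qed.

HB.instance Definition _ := isPzAlgebra.Build K skew
  skew_scaleA skew_scale1r skew_scaleDr skew_scaleDl skew_scaleAl skew_scaleAr.

(* The generators a delta_s - a delta_t, s <= t and a in 1_s A, of N. *)
Definition skew_rel (w : skew) : Prop :=
  exists s t a, [/\ natural_le s t, exists b, a = 'u_s * b &
    skew_val w = << a *g s >> - << a *g t >>].

Definition crossed_product := ideal_quot skew_rel.

HB.instance Definition _ := PzAlgebra.on crossed_product.

Lemma skew_incl_subproof a : << a *g 1%g >> \in in_skew.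
Proof. by apply: in_skewU; rewrite act_unit1 mul1r. Qed.

(* a |-> class of a delta_1 *)
Definition crossed_incl (a : A) : crossed_product :=
  ideal_pi skew_rel (Skew (skew_incl_subproof a)).

Fact crossed_incl_is_zmod_morphism : zmod_morphism crossed_incl.
Proof.
move=> a b; rewrite /crossed_incl -rmorphB; congr (ideal_pi _ _).
by apply: val_inj; rewrite /= monalgUB.
Qed.

Fact crossed_incl_is_monoid_morphism : monoid_morphism crossed_incl.
Proof.
split=> [|a b]; first by congr (ideal_pi _ _); apply: val_inj.
rewrite /crossed_incl -rmorphM; congr (ideal_pi _ _); apply: val_inj => /=.
by rewrite malg_skew_mulU act_ext1 mulg1.
Qed.

Fact crossed_inclZ k : {morph crossed_incl : a / ascale k a}.
Proof.
move=> a; rewrite /crossed_incl -amorphZ; congr (ideal_pi _ _).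
by apply: val_inj; rewrite /= malg_skew_scaleU.
Qed.

HB.instance Definition _ := GRing.isZmodMorphism.Build A crossed_product
  crossed_incl crossed_incl_is_zmod_morphism.
HB.instance Definition _ := GRing.isMonoidMorphism.Build A crossed_product
  crossed_incl crossed_incl_is_monoid_morphism.
HB.instance Definition _ := isAlgScalable.Build K A crossed_product
  crossed_incl crossed_inclZ.

End CrossedProduct.

(* Main.v *)
From HB Require Import structures.
From mathcomp Require Import all_boot all_algebra.
From mathcomp Require Import boolp finmap monalg.
Require Import Defs.

Set Implicit Arguments.
Unset Strict Implicit.
Unset Printing Implicit Defensive.

Import GRing.Theory Quotient.
Local Open Scope ring_scope.
Local Open Scope quotient_scope.

(* Call a module N locally projective when every finite subset of N is fixed by
   an endomorphism of finite rank x |-> \sum_i phi_i(x) p_i with phi_i in the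
   dual of N.  Such a module is flat: an element w of M (x) N is recovered as
   \sum_i (1 (x) phi_i)(w) (x) p_i, and the maps 1 (x) phi_i are natural in M.
   The crossed product R is locally projective as a left and as a right
   A-module.  For the minimum group congruence ~ of S, the coefficient maps
   a delta_s |-> [s ~ t] a (left) and a delta_s |-> [s ~ t] theta_{s^-1}(a)
   (right) descend to R, and in an E-unitary S one has
   1_s a delta_t = 1_t a delta_s in R as soon as s ~ t, so that the t-th
   coefficient map times 1_t delta_t fixes the generators a delta_t and sends
   every a delta_s to some a' delta_s.  Tensoring left and right dual systems
   over K makes R^e locally projective over A^e. *)

(** * Contraction of a tensor product along a linear form *)

Section LocallyProjective.
Variable R : pzRingType.

Definition fin_rank (N : lmodType R) (I : seq ({linear N -> R^o} * N)) (x : N) :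
    N := \sum_(i <- I) (i.1 x : R) *: i.2.

Definition locally_projective (N : lmodType R) : Prop :=
  forall X : seq N, exists I, {in X, fin_rank I =1 id}.

Section Contract.
Variables (M : lmodType R^c) (N : lmodType R) (phi : {linear N -> R^o}).

(** The map 1 (x) phi from M (x) N to M (x) R, followed by the identification of M (x) R with M. *)
Definition contract : tensor_mod M N -> M :=
  tensor_lift (fun m n => (phi n : R^c) *: m).

Lemma contract_balanced :
  balanced (fun (m : M) (r : R) => (r : R^c) *: m)
    (fun (r : R) (n : N) => r *: n) (fun m n => (phi n : R^c) *: m).
Proof.
split=> [n m m'|m n n'|m r n]; first exact: scalerDr.
  by rewrite linearD scalerDl.
by rewrite scalerA linearZ.
Qed.

Lemma contractE m n : contract (mtens m n) = (phi n : R^c) *: m.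
Proof. exact: (tensor_liftE contract_balanced). Qed.

Lemma contractD : {morph contract : t u / t + u}.
Proof. exact: (tensor_liftD contract_balanced). Qed.

End Contract.

Section ContractR.
Variables (M : lmodType R^c) (N : lmodType R) (phi : {linear M -> R^c^o}).

Definition contractr : tensor_mod M N -> N :=
  tensor_lift (fun m n => (phi m : R) *: n).

Lemma contractr_balanced :
  balanced (fun (m : M) (r : R) => (r : R^c) *: m)
    (fun (r : R) (n : N) => r *: n) (fun m n => (phi m : R) *: n).
Proof.
split=> [n m m'|m n n'|m r n].
- by rewrite linearD scalerDl.
- exact: scalerDr.
by rewrite linearZ scalerA.
Qed.

Lemma contractrE m n : contractr (mtens m n) = (phi m : R) *: n.
Proof. exact: (tensor_liftE contractr_balanced). Qed.

Lemma contractrD : {morph contractr : t u / t + u}.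
Proof. exact: (tensor_liftD contractr_balanced). Qed.

End ContractR.
End LocallyProjective.

(** * Local projectivity implies flatness *)

Section FlatOfLocallyProjective.
Variable R : pzRingType.

(** [X] collects the right factors of a presentation of [w] by pure tensors. It depends on [w] only,
    so one [I] can serve several tensors at once. *)
Lemma tensor_expandr (M : lmodType R^c) (N : lmodType R) (w : tensor_mod M N) :
  exists X : seq N, forall I, {in X, fin_rank I =1 id} ->
    w = \sum_(i <- I) mtens (contract i.1 w) i.2.
Proof.
elim/tensor_ind: w => [t u [X tX] [Y uY]|m n]; last first.
  exists [:: n] => I /(_ n (mem_head _ _)) nI.
  rewrite -[tens _ _ _ _]/(mtens m n) -[in LHS]nI /fin_rank.
  rewrite (big_morph (mtens m) (@tensDr _ _ _ _ _ m) (@tens0r _ _ _ _ _ m)).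
  by apply: eq_bigr => i _; rewrite contractE [RHS]tensA.
exists (X ++ Y) => I XYI.
have XI : {in X, fin_rank I =1 id}.
  by move=> x Xx; apply: XYI; rewrite mem_cat Xx.
have YI : {in Y, fin_rank I =1 id}.
  by move=> x Yx; apply: XYI; rewrite mem_cat Yx orbT.
rewrite [in LHS](tX I XI) [in LHS](uY I YI).
rewrite -big_split; apply: eq_bigr => i _ /=.
by rewrite contractD [RHS]tensDl.
Qed.

Lemma tensor_expandl (M : lmodType R^c) (N : lmodType R) (w : tensor_mod M N) :
  exists X : seq M, forall I, {in X, fin_rank I =1 id} ->
    w = \sum_(i <- I) mtens i.2 (contractr i.1 w).
Proof.
elim/tensor_ind: w => [t u [X tX] [Y uY]|m n]; last first.
  exists [:: m] => I /(_ m (mem_head _ _)) mI.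
  rewrite -[tens _ _ _ _]/(mtens m n) -[in LHS]mI /fin_rank.
  rewrite (big_morph (fun m' => mtens m' n)
    (@tensDl _ _ _ _ _ n) (@tens0l _ _ _ _ _ n)).
  by apply: eq_bigr => i _; rewrite contractrE [LHS]tensA.
exists (X ++ Y) => I XYI.
have XI : {in X, fin_rank I =1 id}.
  by move=> x Xx; apply: XYI; rewrite mem_cat Xx.
have YI : {in Y, fin_rank I =1 id}.
  by move=> x Yx; apply: XYI; rewrite mem_cat Yx orbT.
rewrite [in LHS](tX I XI) [in LHS](uY I YI).
rewrite -big_split; apply: eq_bigr => i _ /=.
by rewrite contractrD [RHS]tensDr.
Qed.

(** One [I] is chosen for [w] and [w'] together, so that both expand over the same elements [i.2].
    Their coefficients become equal under the injective [f], contraction being natural. *)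
Lemma locally_projective_lflat (N : lmodType R) :
  locally_projective N -> lflat N.
Proof.
move=> lpN M M' f f_inj w w' eqfw.
have cE (phi : {linear N -> R^o}) u :
    contract phi (tensor_mapl f u) = f (contract phi u).
  elim/tensor_ind: u => [t u Et Eu|m n].
    by rewrite contractD linearD -Et -Eu -contractD
       -(tensor_liftD (tensor_mapl_balanced N f)).
  rewrite -[tens _ _ _ _]/(mtens m n) tensor_maplE !contractE.
  by rewrite linearZ.
have [X wX] := tensor_expandr w; have [Y wY] := tensor_expandr w'.
have [I XYI] := lpN (X ++ Y).
have XI : {in X, fin_rank I =1 id}.
  by move=> x Xx; apply: XYI; rewrite mem_cat Xx.
have YI : {in Y, fin_rank I =1 id}.
  by move=> x Yx; apply: XYI; rewrite mem_cat Yx orbT.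
rewrite (wX I XI) (wY I YI).
apply: eq_bigr => i _; congr (mtens _ _); apply: f_inj.
by rewrite -!cE eqfw.
Qed.

Lemma locally_projective_rflat (M : lmodType R^c) :
  locally_projective M -> rflat M.
Proof.
move=> lpM N N' f f_inj w w' eqfw.
have cE (phi : {linear M -> R^c^o}) u :
    contractr phi (tensor_mapr f u) = f (contractr phi u).
  elim/tensor_ind: u => [t u Et Eu|m n].
    by rewrite contractrD linearD -Et -Eu -contractrD
       -(tensor_liftD (tensor_mapr_balanced M f)).
  rewrite -[tens _ _ _ _]/(mtens m n) tensor_maprE !contractrE.
  by rewrite linearZ.
have [X wX] := tensor_expandl w; have [Y wY] := tensor_expandl w'.
have [I XYI] := lpM (X ++ Y).
have XI : {in X, fin_rank I =1 id}.
  by move=> x Xx; apply: XYI; rewrite mem_cat Xx.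
have YI : {in Y, fin_rank I =1 id}.
  by move=> x Yx; apply: XYI; rewrite mem_cat Yx orbT.
rewrite (wX I XI) (wY I YI).
apply: eq_bigr => i _; congr (mtens _ _); apply: f_inj.
by rewrite -!cE eqfw.
Qed.

End FlatOfLocallyProjective.

(** * A criterion for local projectivity *)

Section StableGenerators.
Variables (R : pzRingType) (N : lmodType R) (S : eqType) (G : S -> N -> Prop).
Variables (phi : S -> {linear N -> R^o}) (p : S -> N).
(** In the application [G s] is the set of all classes a delta_s. There [phi t] need not vanish on
    [G s] for t distinct from s, so stability of [G s] takes the place of the orthogonality of a
    dual basis. *)
Hypothesis G_fix : forall s x, G s x -> (phi s x : R) *: p s = x.
Hypothesis G_stable :
  forall s t x, G s x -> G s (x - (phi t x : R) *: p t).
Hypothesis G_span : forall P : N -> Prop,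
  (forall x y, P x -> P y -> P (x + y)) -> (forall s x, G s x -> P x) ->
  forall x, P x.

Lemma fin_rankD (I : seq ({linear N -> R^o} * N)) :
  {morph fin_rank I : x y / x + y}.
Proof.
move=> x y; rewrite /fin_rank -big_split; apply: eq_bigr => i _ /=.
by rewrite linearD scalerDl.
Qed.

Lemma fin_rank0 (I : seq ({linear N -> R^o} * N)) : fin_rank I 0 = 0.
Proof. by rewrite /fin_rank big1 // => i _; rewrite linear0 scale0r. Qed.

Lemma fin_rankB (I : seq ({linear N -> R^o} * N)) :
  {morph fin_rank I : x y / x - y}.
Proof.
move=> x y; rewrite /fin_rank -sumrB; apply: eq_bigr => i _ /=.
by rewrite linearB scalerBl.
Qed.

Lemma fin_rankZ (I : seq ({linear N -> R^o} * N)) r x :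
  fin_rank I (r *: x) = r *: fin_rank I x.
Proof.
rewrite /fin_rank scaler_sumr; apply: eq_bigr => i _.
by rewrite linearZ scalerA.
Qed.

(* With T_t = phi t (_) *: p t, if T fixes the generators at the indices in L,
   then T_t + T - T T_t fixes those at the indices in t :: L. *)
Lemma stable_generators_fix (L : seq S) :
  exists I : seq ({linear N -> R^o} * N),
    forall s x, s \in L -> G s x -> fin_rank I x = x.
Proof.
elim: L => [|t L [I LI]]; first by exists [::].
(* As T is linear, T_t - T T_t is again of rank one, with form [phi t] and vector [p t] minus its
   image under T. *)
exists ((phi t, p t - fin_rank I (p t)) :: I) => s x.
have -> : fin_rank ((phi t, p t - fin_rank I (p t)) :: I) x =
    (phi t x : R) *: p t + fin_rank I (x - (phi t x : R) *: p t).
  by rewrite {1}/fin_rank big_cons /= fin_rankB fin_rankZ scalerBr addrAC addrA.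
rewrite inE => /predU1P[-> Gx|Ls Gx].
  by rewrite G_fix// subrr fin_rank0 addr0.
by rewrite (LI s) ?subrKC //; exact: G_stable.
Qed.

(** [L] lists the indices of the generators in a decomposition of [x]. *)
Lemma stable_generators_support x :
  exists L : seq S, forall I : seq ({linear N -> R^o} * N),
    (forall s y, s \in L -> G s y -> fin_rank I y = y) -> fin_rank I x = x.
Proof.
elim/G_span: x => [x y [L xL] [L' yL']|s x Gx]; last first.
  by exists [:: s] => I LI; apply: LI Gx; rewrite mem_head.
exists (L ++ L') => I LI; rewrite fin_rankD xL ?yL' // => s z Ls; apply: LI.
  by rewrite mem_cat Ls orbT.
by rewrite mem_cat Ls.
Qed.

Lemma stable_generators_locally_projective : locally_projective N.
Proof.
move=> X; suff [L XL] : exists L : seq S,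
    forall I : seq ({linear N -> R^o} * N),
    (forall s y, s \in L -> G s y -> fin_rank I y = y) ->
    {in X, fin_rank I =1 id}.
  by have [I LI] := stable_generators_fix L; exists I; exact: XL.
elim: X => [|x X [L XL]]; first by exists [::].
have [L' xL'] := stable_generators_support x.
exists (L' ++ L) => I LI y; rewrite inE => /predU1P[->|].
  by apply: xL' => s z Ls; apply: LI; rewrite mem_cat Ls.
by apply: XL => s z Ls; apply: LI; rewrite mem_cat Ls orbT.
Qed.

End StableGenerators.

Lemma scale_regularE (R : pzRingType) (a : R) (x : R^o) :
  a *: x = a * (x : R).
Proof. by []. Qed.

Lemma scale_converse_regularE (R : pzRingType) (a : R^c) (x : R^c^o) :
  a *: x = (x : R) * (a : R).
Proof. by []. Qed.

(** * Local projectivity of enveloping algebras *)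

Section EnvelopingLocallyProjective.
Variables (K : comPzRingType) (A R : pzAlgType K) (f : {amorphism A -> R}).
Implicit Types (phi : {linear lrestr f -> A^o}).
Implicit Types (psi : {linear rrestr f -> A^c^o}).

Lemma lrestr_dualD phi : {morph (phi : R -> A) : x y / x + y}.
Proof. by move=> x y; exact: (linearD phi). Qed.

Lemma rrestr_dualD psi : {morph (psi : R -> A) : x y / x + y}.
Proof. by move=> x y; exact: (linearD psi). Qed.

(** A scalar k acts on [R] as left multiplication by the image of k 1, so [A]-linearity yields the
    [K]-linearity required for tensoring forms over [K]. *)
Lemma lrestr_dualZ phi k (x : R) :
  phi (ascale k x) = ascale k (phi x : A) :> A.
Proof.
have -> : ascale k x = f (ascale k 1) * x.
  by rewrite amorphZ rmorph1 -ascaleAl mul1r.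
rewrite -[f _ * x]/(ascale k 1 *: (x : lrestr f)) linearZ.
by rewrite -[LHS]/(ascale k 1 * (phi x : A)) -ascaleAl mul1r.
Qed.

Lemma rrestr_dualZ psi k (x : R) :
  psi (ascale k x) = ascale k (psi x : A) :> A.
Proof.
have -> : ascale k x = x * f (ascale k 1).
  by rewrite amorphZ rmorph1 -ascaleAr mulr1.
rewrite -[x * f _]/((ascale k 1 : A^c) *: (x : rrestr f)) linearZ.
by rewrite -[LHS]/((psi x : A) * ascale k 1) -ascaleAr mulr1.
Qed.

Lemma etensDl (y : R) : {morph (fun x => etens x y) : x x' / x + x'}.
Proof. exact: (@tensDl K R R^c). Qed.
Lemma etensDr (x : R) : {morph etens x : y y' / y + y'}.
Proof. exact: (@tensDr K R R^c). Qed.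
Lemma etens0l (y : R) : etens 0 y = 0.
Proof. exact: (@tens0l K R R^c). Qed.
Lemma etens0r (x : R) : etens x 0 = 0.
Proof. exact: (@tens0r K R R^c). Qed.

Section Dual.
Variables (alpha beta : R -> A).

Definition env_dual (u : env R) : env A :=
  tensor_lift (fun x y => etens (alpha x) (beta y)) u.

Hypotheses (alphaD : {morph alpha : x y / x + y})
  (alphaZ : forall k, {morph alpha : x / ascale k x})
  (betaD : {morph beta : x y / x + y})
  (betaZ : forall k, {morph beta : x / ascale k x}).

Lemma env_dual_balanced :
  balanced (fun (x : R) (k : K) => ascale k x)
    (fun (k : K) (y : R^c) => ascale k y)
    (fun x y => etens (alpha x) (beta y)).
Proof.
split=> [n m m'|m n n'|m r n].
- by rewrite alphaD /etens tensDl.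
- by rewrite betaD /etens tensDr.
by rewrite alphaZ betaZ /etens tensA.
Qed.

Lemma env_dualE x y : env_dual (etens x y) = etens (alpha x) (beta y).
Proof. exact: (tensor_liftE env_dual_balanced). Qed.

Lemma env_dualD : {morph env_dual : u v / u + v}.
Proof. exact: (tensor_liftD env_dual_balanced). Qed.

End Dual.

(** In the left A^e-module R^e the first tensor factor is a left and the second a right A-module. In
    the right A^e-module the roles are exchanged, hence the opposite order of [phi] and [psi]. *)
Definition env_ldual phi psi : env_lmod f -> (env A)^o := env_dual phi psi.
Definition env_rdual phi psi : env_rmod f -> (env A)^c^o := env_dual psi phi.

Lemma env_ldualE phi psi x y :
  env_ldual phi psi (etens x y) = etens (phi x) (psi y).
Proof.
by apply: env_dualE; [exact: lrestr_dualD|exact: lrestr_dualZ|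
  exact: rrestr_dualD|exact: rrestr_dualZ].
Qed.

Lemma env_rdualE phi psi x y :
  env_rdual phi psi (etens x y) = etens (psi x) (phi y).
Proof.
by apply: env_dualE; [exact: rrestr_dualD|exact: rrestr_dualZ|
  exact: lrestr_dualD|exact: lrestr_dualZ].
Qed.

Lemma env_ldualD phi psi : {morph env_ldual phi psi : u v / u + v}.
Proof.
by apply: env_dualD; [exact: lrestr_dualD|exact: lrestr_dualZ|
  exact: rrestr_dualD|exact: rrestr_dualZ].
Qed.

Lemma env_rdualD phi psi : {morph env_rdual phi psi : u v / u + v}.
Proof.
by apply: env_dualD; [exact: rrestr_dualD|exact: rrestr_dualZ|
  exact: lrestr_dualD|exact: lrestr_dualZ].
Qed.

Fact env_ldual_linear phi psi : linear (env_ldual phi psi).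
Proof.
move=> c u v; rewrite env_ldualD; congr (_ + _).
elim/env_ind: c => [c d Ec Ed|a b].
  by rewrite !scalerDl env_ldualD Ec Ed.
elim/env_ind: u => [u w Eu Ew|x y].
  by rewrite scalerDr !env_ldualD scalerDr Eu Ew.
rewrite env_lmodE !env_ldualE.
rewrite -[f a * x]/(a *: (x : lrestr f)) linearZ.
rewrite -[y * f b]/((b : A^c) *: (y : rrestr f)) linearZ.
by rewrite !scale_regularE etensM.
Qed.

Fact env_rdual_linear phi psi : linear (env_rdual phi psi).
Proof.
move=> c u v; rewrite env_rdualD; congr (_ + _).
elim/env_ind: c => [c d Ec Ed|a b].
  by rewrite !scalerDl env_rdualD Ec Ed.
elim/env_ind: u => [u w Eu Ew|x y].
  by rewrite scalerDr !env_rdualD scalerDr Eu Ew.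
rewrite env_rmodE !env_rdualE.
rewrite -[x * f a]/((a : A^c) *: (x : rrestr f)) linearZ.
rewrite -[f b * y]/(b *: (y : lrestr f)) linearZ.
by rewrite !scale_converse_regularE etensM.
Qed.

HB.instance Definition _ phi psi :=
  GRing.isLinear.Build (env A) (env_lmod f) (env A)^o *:%R
    (env_ldual phi psi) (env_ldual_linear phi psi).
HB.instance Definition _ phi psi :=
  GRing.isLinear.Build (env A)^c (env_rmod f) (env A)^c^o *:%R
    (env_rdual phi psi) (env_rdual_linear phi psi).

Definition env_ldual_seq (I : seq ({linear lrestr f -> A^o} * lrestr f))
    (J : seq ({linear rrestr f -> A^c^o} * rrestr f)) :
    seq ({linear env_lmod f -> (env A)^o} * env_lmod f) :=
  [seq (env_ldual i.1 j.1 : {linear _ -> _}, etens (i.2 : R) (j.2 : R))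
    | i <- I, j <- J].

Definition env_rdual_seq (I : seq ({linear lrestr f -> A^o} * lrestr f))
    (J : seq ({linear rrestr f -> A^c^o} * rrestr f)) :
    seq ({linear env_rmod f -> (env A)^c^o} * env_rmod f) :=
  [seq (env_rdual i.1 j.1 : {linear _ -> _}, etens (j.2 : R) (i.2 : R))
    | i <- I, j <- J].

Lemma etens_sum (T U : Type) (r : seq T) (q : seq U) (F : T -> R) (G : U -> R) :
  etens (\sum_(i <- r) F i) (\sum_(j <- q) G j) =
    \sum_(i <- r) \sum_(j <- q) etens (F i) (G j).
Proof.
rewrite (big_morph (fun x => etens x _) (@etensDl _) (@etens0l _)).
apply: eq_bigr => i _.
by rewrite (big_morph _ (@etensDr _) (@etens0r _)).
Qed.

(** The product system induces the tensor product of the two finite rank maps, because A^e acts on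
    each factor of a pure tensor separately. *)
Lemma fin_rank_env_ldual I J x y :
  fin_rank (env_ldual_seq I J) (etens x y) =
    etens (fin_rank I x : R) (fin_rank J y : R).
Proof.
rewrite [RHS]etens_sum /fin_rank big_allpairs_dep; apply: eq_bigr => i _.
apply: eq_bigr => j _.
by rewrite -[LHS]/((env_ldual i.1 j.1 (etens x y) : (env A)) *:
  (etens (i.2 : R) (j.2 : R) : env_lmod f)) env_ldualE env_lmodE.
Qed.

Lemma fin_rank_env_rdual I J x y :
  fin_rank (env_rdual_seq I J) (etens x y) =
    etens (fin_rank J x : R) (fin_rank I y : R).
Proof.
(* Here [I] belongs to the second tensor factor, so the double sum is reordered. *)
rewrite [RHS]etens_sum exchange_big /fin_rank big_allpairs_dep.
apply: eq_bigr => i _.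
apply: eq_bigr => j _.
by rewrite -[LHS]/((env_rdual i.1 j.1 (etens x y) : (env A)^c) *:
  (etens (j.2 : R) (i.2 : R) : env_rmod f)) env_rdualE env_rmodE.
Qed.

(** [X] and [Y] list the left and right factors of a presentation of [u] by pure tensors. *)
Lemma env_ldual_support (u : env R) :
  exists (X : seq (lrestr f)) (Y : seq (rrestr f)), forall I J,
    {in X, fin_rank I =1 id} -> {in Y, fin_rank J =1 id} ->
    fin_rank (env_ldual_seq I J) u = u :> env_lmod f.
Proof.
elim/env_ind: u => [u v [X [Y uXY]] [X' [Y' vXY']]|x y]; last first.
  exists [:: x], [:: y] => I J xI yJ.
  by rewrite fin_rank_env_ldual xI ?yJ ?mem_head.
exists (X ++ X'), (Y ++ Y') => I J XI YJ.
rewrite fin_rankD uXY ?vXY' // => z Xz;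
  by [apply: XI; rewrite mem_cat Xz ?orbT|apply: YJ; rewrite mem_cat Xz ?orbT].
Qed.

Lemma env_lmod_locally_projective :
  locally_projective (lrestr f) -> locally_projective (rrestr f) ->
  locally_projective (env_lmod f).
Proof.
move=> lpl lpr U; suff [X [Y XYU]] : exists (X : seq (lrestr f))
    (Y : seq (rrestr f)), forall I J, {in X, fin_rank I =1 id} ->
    {in Y, fin_rank J =1 id} -> {in U, fin_rank (env_ldual_seq I J) =1 id}.
  have [I XI] := lpl X; have [J YJ] := lpr Y.
  by exists (env_ldual_seq I J); exact: XYU.
elim: U => [|u U [X [Y UXY]]]; first by exists [::], [::].
have [X' [Y' uXY']] := env_ldual_support u.
exists (X' ++ X), (Y' ++ Y) => I J XI YJ v; rewrite inE => /predU1P[->|Uv].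
  by apply: uXY' => z Xz; [apply: XI|apply: YJ]; rewrite mem_cat Xz.
by apply: UXY Uv => z Xz; [apply: XI|apply: YJ]; rewrite mem_cat Xz orbT.
Qed.

Lemma env_rdual_support (u : env R) :
  exists (X : seq (lrestr f)) (Y : seq (rrestr f)), forall I J,
    {in X, fin_rank I =1 id} -> {in Y, fin_rank J =1 id} ->
    fin_rank (env_rdual_seq I J) u = u :> env_rmod f.
Proof.
elim/env_ind: u => [u v [X [Y uXY]] [X' [Y' vXY']]|y x]; last first.
  exists [:: x], [:: y] => I J xI yJ.
  by rewrite fin_rank_env_rdual xI ?yJ ?mem_head.
exists (X ++ X'), (Y ++ Y') => I J XI YJ.
rewrite fin_rankD uXY ?vXY' // => z Xz;
  by [apply: XI; rewrite mem_cat Xz ?orbT|apply: YJ; rewrite mem_cat Xz ?orbT].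
Qed.

Lemma env_rmod_locally_projective :
  locally_projective (lrestr f) -> locally_projective (rrestr f) ->
  locally_projective (env_rmod f).
Proof.
move=> lpl lpr U; suff [X [Y XYU]] : exists (X : seq (lrestr f))
    (Y : seq (rrestr f)), forall I J, {in X, fin_rank I =1 id} ->
    {in Y, fin_rank J =1 id} -> {in U, fin_rank (env_rdual_seq I J) =1 id}.
  have [I XI] := lpl X; have [J YJ] := lpr Y.
  by exists (env_rdual_seq I J); exact: XYU.
elim: U => [|u U [X [Y UXY]]]; first by exists [::], [::].
have [X' [Y' uXY']] := env_rdual_support u.
exists (X' ++ X), (Y' ++ Y) => I J XI YJ v; rewrite inE => /predU1P[->|Uv].
  by apply: uXY' => z Xz; [apply: XI|apply: YJ]; rewrite mem_cat Xz.
by apply: UXY Uv => z Xz; [apply: XI|apply: YJ]; rewrite mem_cat Xz orbT.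
Qed.

End EnvelopingLocallyProjective.

(** * Idempotents, natural order and minimum group congruence *)

Section InverseMonoidTheory.
Variable S : invMonoidType.
Implicit Types e f q r s t : S.
Local Open Scope group_scope.

Lemma iinv_involutive s : iinv (iinv s) = s.
Proof. by apply/esym/iinv_uniq; rewrite ?mulg_iinvK ?iinv_mulgK. Qed.

Lemma idempotent_iinv e : idempotent_elt e -> iinv e = e.
Proof. by move=> ee; apply/esym/iinv_uniq; rewrite ee. Qed.

(** The inverse x of e f equals f x e by uniqueness of inverses, which makes x idempotent. Then x is
    its own inverse, so e f = x. *)
Lemma idempotentM e f :
  idempotent_elt e -> idempotent_elt f -> idempotent_elt (e * f).
Proof.
rewrite /idempotent_elt => ee ff; set x := iinv (e * f).
have xK : x * (e * f) * x = x := iinv_mulgK (e * f).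
have xE : f * x * e = x.
  apply: iinv_uniq.
    rewrite -[RHS](mulg_iinvK (e * f)) -/x !mulgA.
    by rewrite -(mulgA e f f) ff -(mulgA _ e e) ee.
  by rewrite -{3}xK !mulgA -(mulgA _ e e) ee -(mulgA _ f f) ff.
have xx : x * x = x.
  have : (f * x * e) * (f * x * e) = f * x * e by rewrite -{3}xK !mulgA.
  by rewrite xE.
by rewrite -(iinv_involutive (e * f)) -/x (idempotent_iinv xx).
Qed.

(** Both e f and f e are inverses of the idempotent e f. *)
Lemma idempotentC e f :
  idempotent_elt e -> idempotent_elt f -> e * f = f * e.
Proof.
move=> ee ff; have ef := idempotentM ee ff; have fe := idempotentM ff ee.
rewrite -(idempotent_iinv ef); apply/esym/iinv_uniq.
  by rewrite !mulgA -(mulgA _ f f) ff -(mulgA _ e e) ee -mulgA ef.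
by rewrite !mulgA -(mulgA _ e e) ee -(mulgA _ f f) ff -mulgA fe.
Qed.

Lemma idempotent_mulV s : idempotent_elt (s * iinv s).
Proof. by rewrite /idempotent_elt mulgA mulg_iinvK. Qed.

Lemma idempotent_mulVl s : idempotent_elt (iinv s * s).
Proof. by rewrite /idempotent_elt mulgA iinv_mulgK. Qed.

Lemma iinv_idemM e s : idempotent_elt e -> iinv (e * s) = iinv s * e.
Proof.
move=> ee; have es := idempotentC ee (idempotent_mulV s).
apply/esym/iinv_uniq.
  rewrite !mulgA -(mulgA _ e e) ee -(mulgA e s) es -(mulgA _ e e) ee -es.
  by rewrite -!mulgA (mulgA s) mulg_iinvK.
rewrite !mulgA -(mulgA _ e e) ee -(mulgA _ s) -(mulgA _ e) es !mulgA.
by rewrite -(mulgA _ e e) ee iinv_mulgK.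
Qed.

Lemma idempotent_conj s e :
  idempotent_elt e -> idempotent_elt (s * e * iinv s).
Proof.
move=> ee; rewrite /idempotent_elt !mulgA.
by rewrite -(mulgA _ (iinv s) s) -(mulgA s e)
  (idempotentC ee (idempotent_mulVl s)) !mulgA mulg_iinvK -(mulgA s e e) ee.
Qed.

(** Moves an idempotent from the right of s to the left, where [natural_le] expects it. *)
Lemma mul_idem_conj s e : idempotent_elt e -> s * e = s * e * iinv s * s.
Proof.
move=> ee; rewrite -!mulgA (idempotentC ee (idempotent_mulVl s)) !mulgA.
by rewrite mulg_iinvK.
Qed.

Lemma natural_leMr s t r : natural_le s t -> natural_le (s * r) (t * r).
Proof. by move=> [e ee ->]; exists e; rewrite ?mulgA. Qed.

Lemma natural_leMl s t r : natural_le s t -> natural_le (r * s) (r * t).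
Proof.
move=> [e ee ->]; exists (r * e * iinv r); first exact: idempotent_conj.
by rewrite !mulgA -mul_idem_conj.
Qed.

Lemma natural_le_mulr s e : idempotent_elt e -> natural_le (s * e) s.
Proof.
by move=> ee; exists (s * e * iinv s);
  [exact: idempotent_conj|exact: mul_idem_conj].
Qed.

Lemma natural_le_mull e s : idempotent_elt e -> natural_le (e * s) s.
Proof. by exists e. Qed.

Lemma natural_le_refl s : natural_le s s.
Proof.
by exists (s * iinv s); [exact: idempotent_mulV|rewrite mulg_iinvK].
Qed.

Lemma natural_le_trans s t r :
  natural_le s t -> natural_le t r -> natural_le s r.
Proof.
move=> [e ee ->] [f ff ->]; exists (e * f); first exact: idempotentM.
by rewrite mulgA.
Qed.

(* The minimum group congruence. *)
Definition bounded_below s t : Prop :=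
  exists2 q, natural_le q s & natural_le q t.

Lemma bounded_below_refl s : bounded_below s s.
Proof. by exists s; exact: natural_le_refl. Qed.

(** This makes the coefficient maps respect the relations a delta_s = a delta_r. For the converse,
    with s = g r, a lower bound q of r and t is cut down to g q. *)
Lemma bounded_below_le s r t :
  natural_le s r -> bounded_below s t <-> bounded_below r t.
Proof.
move=> sr; split=> [[q qs qt]|[q [e ee ->] [f ff et]]].
  by exists q => //; exact: natural_le_trans sr.
case: sr => g gg ->; exists (e * g * r).
  by exists e; rewrite ?mulgA.
exists (g * f); first exact: idempotentM.
by rewrite -(mulgA g) -et mulgA (idempotentC ee gg).
Qed.

(** * Congruent elements of an E-unitary inverse monoid *)

Section EUnitary.
Hypothesis S_EU : E_unitary S.

(** If q = e s = f t, then the idempotent q q^-1 = f t s^-1 e lies below t s^-1. *)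
Lemma E_unitary_mulV s t :
  bounded_below s t -> idempotent_elt (t * iinv s).
Proof.
move=> [q [e ee qe] [f ff qf]].
apply: S_EU (idempotent_mulV q) _; rewrite {1}qf qe iinv_idemM // -mulgA.
apply: natural_le_trans (natural_le_mull _ ff) _; rewrite mulgA.
exact: natural_le_mulr.
Qed.

Lemma E_unitary_Vmul s t :
  bounded_below s t -> idempotent_elt (iinv t * s).
Proof.
move=> [q [e ee qe] [f ff qf]].
apply: S_EU (idempotent_mulVl q) _; rewrite {1}qf qe iinv_idemM //.
rewrite mulgA -(mulgA _ f e); apply: natural_leMr.
exact/natural_le_mulr/idempotentM.
Qed.

End EUnitary.
End InverseMonoidTheory.

(** * Generators and universal property of the crossed product *)

Section CrossedProductTheory.
Variables (K : comPzRingType) (A : pzAlgType K) (S : invMonoidType).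
Variable theta : unital_action A S.
Implicit Types (s t r : S) (a b : A).

Local Notation "'u_ s" := (act_unit theta s) (at level 3, s at level 2).
Local Notation L := (skew theta).
Local Notation R := (crossed_product theta).

Lemma act_unitCA s a b : a * ('u_s * b) = 'u_s * (a * b).
Proof. by rewrite !mulrA act_unit_central. Qed.

Lemma act_unitK s a : 'u_s * ('u_s * a) = 'u_s * a.
Proof. by rewrite mulrA act_unit_idem. Qed.

Lemma act_ext_unitK s a : act_ext theta s ('u_(iinv s) * a) = act_ext theta s a.
Proof. by apply: Some_inj; rewrite -!act_extE act_unitK. Qed.

Lemma act_unit_mulV s : 'u_(s * iinv s)%g = 'u_s.
Proof.
by rewrite act_unit_mul -[X in act_ext _ _ X]mulr1 act_ext_unitK act_ext_unitr.
Qed.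

Lemma act_ext_le s t b :
  natural_le s t -> act_ext theta s b = 'u_s * act_ext theta t b.
Proof.
move=> [e ee ->]; rewrite act_ext_mul act_unit_mul !(act_ext_idem _ _ ee).
by rewrite -mulrA act_ext_unit.
Qed.

Lemma act_ext0 s : act_ext theta s 0 = 0.
Proof. by apply: (addIr (act_ext theta s 0)); rewrite -act_extD !add0r. Qed.

(** The factor 1_s makes a delta_s available for every a in A, so that calculations carry no
    membership conditions. *)
Definition skew_gen s a : L :=
  Skew (@in_skewU _ _ _ theta ('u_s * a) s (act_unitK s a)).

Lemma skew_genD s : {morph skew_gen s : a b / a + b}.
Proof. by move=> a b; apply: val_inj; rewrite /= mulrDr monalgUD. Qed.

Lemma skew_genM s t a b :
  skew_gen s a * skew_gen t b = skew_gen (s * t)%g (a * act_ext theta s b).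
Proof.
apply: val_inj; rewrite /= malg_skew_mulU act_extM -act_unit_mul.
by rewrite act_unitCA -mulrA -(act_unitCA s) act_ext_unit.
Qed.

Lemma skew_gen_ind (P : L -> Prop) :
  P 0 -> (forall w v, P w -> P v -> P (w + v)) ->
  (forall s a, P (skew_gen s a)) -> forall w, P w.
Proof.
move=> P0 PD PG w.
have -> : w = \sum_(s <- msupp (skew_val w)) skew_gen s (skew_val w)@_s.
  apply: skew_val_inj; rewrite (big_morph _ (@skew_valD _ _ _ theta)
    (erefl : skew_val (0 : L) = 0)).
  rewrite [LHS]monalgE; apply: eq_bigr => s _ /=.
  by have /in_skewP -> := skewP w.
by elim/big_ind: _ => // s _; exact: PG.
Qed.

Definition cgen s a : R := ideal_pi (@skew_rel K A S theta) (skew_gen s a).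

Lemma cgenD s : {morph cgen s : a b / a + b}.
Proof. by move=> a b; rewrite /cgen skew_genD ideal_piD. Qed.

Lemma cgenB s : {morph cgen s : a b / a - b}.
Proof.
by move=> a b; apply: (addIr (cgen s b)); rewrite subrK -cgenD subrK.
Qed.

Lemma cgen0 s : cgen s 0 = 0.
Proof. by rewrite -[in LHS](subrr 0) cgenB subrr. Qed.

Lemma cgenM s t a b :
  cgen s a * cgen t b = cgen (s * t)%g (a * act_ext theta s b).
Proof. by rewrite /cgen -skew_genM rmorphM. Qed.

Lemma cgen_unit s a : cgen s ('u_s * a) = cgen s a.
Proof.
by congr (ideal_pi _ _); apply: val_inj; rewrite /= act_unitK.
Qed.

Lemma crossed_inclE a : crossed_incl theta a = cgen 1%g a.
Proof.
by congr (ideal_pi _ _); apply: val_inj; rewrite /= act_unit1 mul1r.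
Qed.

Lemma crossed_inclMl s a b : crossed_incl theta a * cgen s b = cgen s (a * b).
Proof. by rewrite crossed_inclE cgenM mul1g act_ext1. Qed.

Lemma crossed_inclMr s a b :
  cgen s b * crossed_incl theta a = cgen s (b * act_ext theta s a).
Proof. by rewrite crossed_inclE cgenM mulg1. Qed.

Lemma cgen_le s t a : natural_le s t -> cgen s a = cgen t ('u_s * a).
Proof.
move=> st; apply/ideal_piP/gen_ideal_sub; exists s, t, ('u_s * a).
split=> //; first by exists a.
by rewrite /= (act_unit_le st (act_unitK s a)).
Qed.

Lemma crossed_ind (P : R -> Prop) :
  (forall x y, P x -> P y -> P (x + y)) -> (forall s a, P (cgen s a)) ->
  forall x, P x.
Proof.
move=> PD PG; elim/ideal_quotW; elim/skew_gen_ind => [|w v Pw Pv|s a].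
- by rewrite rmorph0 -(cgen0 1%g).
- by rewrite ideal_piD; exact: PD.
exact: PG.
Qed.

(** Multiplying a defining relation by some b delta_r on either side gives a defining relation
    again, so the additive span of the relations is already an ideal. Hence an additive map that
    kills the relations descends to the crossed product. *)
Lemma gen_ideal_skew_rel w :
  w \in gen_ideal (@skew_rel K A S theta) ->
  w \in gen_subgroup (@skew_rel K A S theta).
Proof.
have relP s t a : natural_le s t ->
    skew_gen s a - skew_gen t ('u_s * a) \in
      gen_subgroup (@skew_rel K A S theta).
  move=> st; apply: gen_subgroup_sub; exists s, t, ('u_s * a).
  split=> //; first by exists a.
  by rewrite /= (act_unit_le st (act_unitK s a)).
have relE v : skew_rel v -> exists s t a,
    natural_le s t /\ v = skew_gen s a - skew_gen t ('u_s * a).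
  move=> [s [t [_ [st [a ->] vE]]]]; exists s, t, a; split=> //.
  by apply: val_inj; rewrite /= vE (act_unit_le st (act_unitK s a)).
apply: (@gen_ideal_min _ _
  (fun v => v \in gen_subgroup (@skew_rel K A S theta))); last first.
  by move=> y; exact: gen_subgroup_sub.
split=> [|x y|x y|x y]; [exact: rpred0|exact: rpredB| |].
- apply: (@gen_subgroup_min _ _
    (fun v => x * v \in gen_subgroup (@skew_rel K A S theta))) =>
    [|v /relE[s [t [a [st {v}->]]]]].
    by split=> [|v v' xv xv']; rewrite ?mulr0 ?mulrBr ?rpred0 ?rpredB.
  elim/skew_gen_ind: x => [|v v' xv xv'|r b].
  + by rewrite mul0r rpred0.
  + by rewrite mulrDl rpredD.
  rewrite mulrBr !skew_genM act_extM -act_unit_mul act_unitCA.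
  exact/relP/natural_leMl.
apply: (@gen_subgroup_min _ _
  (fun v => v * y \in gen_subgroup (@skew_rel K A S theta))) =>
  [|v /relE[s [t [a [st {v}->]]]]].
  by split=> [|v v' xv xv']; rewrite ?mul0r ?mulrBl ?rpred0 ?rpredB.
elim/skew_gen_ind: y => [|v v' xv xv'|r b].
- by rewrite mulr0 rpred0.
- by rewrite mulrDr rpredD.
rewrite mulrBl !skew_genM -mulrA -act_unitCA -(act_ext_le b st).
set c := a * _.
(* Both terms have coefficient [c], while [relP] wants 1_(sr) c in the second. With s = e t one has
   1_(sr) = 1_e 1_(tr), and [c] is already fixed by 1_e. *)
have -> : skew_gen (t * r)%g c = skew_gen (t * r)%g ('u_(s * r)%g * c).
  apply: val_inj; congr << _ *g _ >>; case: st => e ee sE.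
  rewrite /c sE -mulgA (act_unit_mul theta e) act_ext_mul.
  rewrite !(act_ext_idem _ _ ee).
  by rewrite act_unitCA -mulrA !(act_unitCA e 'u_(t * r)%g) !act_unitK.
exact/relP/natural_leMr.
Qed.

Section Lift.
Variables (V : zmodType) (F : S -> A -> V).
Hypothesis FD : forall s, {morph F s : a b / a + b}.
Hypothesis F_le : forall s t a,
  natural_le s t -> 'u_s * a = a -> F s a = F t a.

Definition crossed_lift (x : R) : V :=
  mlift F (skew_val (repr (x : {quot (gen_ideal (@skew_rel K A S theta))}))).

(** The chosen representative differs from [w] by a sum of signed defining relations, each of which
    is killed by [F_le]. *)
Lemma crossed_lift_pi w :
  crossed_lift (ideal_pi (@skew_rel K A S theta) w) = mlift F (skew_val w).
Proof.
apply/eqP; rewrite -subr_eq0 -(mliftB FD) -[_ - _]/(skew_val (_ - _)).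
set v := _ - w; have : v \in gen_ideal (@skew_rel K A S theta).
  by apply/ideal_piP; rewrite ideal_pi_reprK.
move/gen_ideal_skew_rel; 
apply: (@gen_subgroup_min _ _ (fun v : L => mlift F (skew_val v) == 0)) =>
  {v} [|v].
  split=> [|x y]; first by rewrite mlift0.
  by rewrite (mliftB FD) => /eqP -> /eqP ->; rewrite subr0.
move=> [s [t [_ [st [a ->] ->]]]]; rewrite (mliftB FD) !(mliftU FD).
by rewrite (F_le st (act_unitK s a)) subrr.
Qed.

Lemma crossed_liftD : {morph crossed_lift : x y / x + y}.
Proof.
elim/ideal_quotW => x; elim/ideal_quotW => y.
by rewrite -ideal_piD !crossed_lift_pi -(mliftD FD).
Qed.

Lemma crossed_lift_gen s a : crossed_lift (cgen s a) = F s ('u_s * a).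
Proof. by rewrite crossed_lift_pi (mliftU FD). Qed.

End Lift.

End CrossedProductTheory.

(** * Coefficient forms and local projectivity of the crossed product *)

Section CrossedProductDuals.
Variables (K : comPzRingType) (A : pzAlgType K) (S : invMonoidType).
Variable theta : unital_action A S.
Implicit Types (s t r : S) (a b : A).

Local Notation "'u_ s" := (act_unit theta s) (at level 3, s at level 2).
Local Notation R := (crossed_product theta).

Definition lcoef t s a : A := if `[< bounded_below s t >] then a else 0.
(** For a in 1_s A, a delta_s is 1_s delta_s times theta_(s^-1)(a), so this is the coefficient on
    the right. *)
Definition rcoef t s a : A :=
  if `[< bounded_below s t >] then act_ext theta (iinv s) a else 0.

Lemma lcoefD t s : {morph lcoef t s : a b / a + b}.
Proof. by move=> a b; rewrite /lcoef; case: ifP; rewrite ?addr0. Qed.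

Lemma rcoefD t s : {morph rcoef t s : a b / a + b}.
Proof. by move=> a b; rewrite /rcoef; case: ifP; rewrite ?addr0 ?act_extD. Qed.

Lemma lcoef_le t s r a :
  natural_le s r -> 'u_s * a = a -> lcoef t s a = lcoef t r a.
Proof.
by move=> sr _; rewrite /lcoef (asbool_equiv_eq (bounded_below_le t sr)).
Qed.

(** With s = e r, theta_(s^-1)(a) = theta_(r^-1)(1_e a), and 1_e fixes a because a lies in 1_s A. *)
Lemma rcoef_le t s r a :
  natural_le s r -> 'u_s * a = a -> rcoef t s a = rcoef t r a.
Proof.
move=> sr sa; rewrite /rcoef (asbool_equiv_eq (bounded_below_le t sr)).
case: ifP => // _; case: sr sa => e ee ->.
rewrite act_unit_mul (act_ext_idem _ _ ee) iinv_idemM // act_ext_mul => sa.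
by rewrite (act_ext_idem _ _ ee) -sa -mulrA act_unitK.
Qed.

Definition crossed_ldual t : lrestr (crossed_incl theta) -> A^o :=
  crossed_lift (lcoef t).
Definition crossed_rdual t : rrestr (crossed_incl theta) -> A^c^o :=
  crossed_lift (rcoef t).

Lemma crossed_ldual_gen t s a :
  crossed_ldual t (cgen theta s a) = lcoef t s ('u_s * a).
Proof. exact: crossed_lift_gen (@lcoefD t) (@lcoef_le t) s a. Qed.

Lemma crossed_rdual_gen t s a :
  crossed_rdual t (cgen theta s a) = rcoef t s a.
Proof.
rewrite [LHS](crossed_lift_gen (@rcoefD t) (@rcoef_le t)) /rcoef.
by have := act_ext_unitK theta (iinv s) a; rewrite iinv_involutive => ->.
Qed.

Lemma crossed_ldualD t : {morph (crossed_ldual t : R -> A) : x y / x + y}.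
Proof. exact: crossed_liftD (@lcoefD t) (@lcoef_le t). Qed.

Lemma crossed_rdualD t : {morph (crossed_rdual t : R -> A) : x y / x + y}.
Proof. exact: crossed_liftD (@rcoefD t) (@rcoef_le t). Qed.

Lemma crossed_ldualM t c (x : R) :
  crossed_ldual t (crossed_incl theta c * x) = c * (crossed_ldual t x : A).
Proof.
elim/crossed_ind: x => [x y Ex Ey|s a].
  by rewrite mulrDr !crossed_ldualD Ex Ey mulrDr.
rewrite crossed_inclMl !crossed_ldual_gen /lcoef.
by case: ifP; rewrite ?mulr0 ?act_unitCA.
Qed.

Lemma crossed_rdualM t c (x : R) :
  crossed_rdual t (x * crossed_incl theta c) = (crossed_rdual t x : A) * c.
Proof.
elim/crossed_ind: x => [x y Ex Ey|s a].
  by rewrite mulrDl !crossed_rdualD Ex Ey mulrDl.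
rewrite crossed_inclMr !crossed_rdual_gen /rcoef.
case: ifP; rewrite ?mul0r // => _; rewrite act_extM -act_ext_mul.
(* Applying theta_(s^-1) after theta_s multiplies c by 1_(s^-1), which the factor theta_(s^-1)(a)
   absorbs. *)
rewrite (act_ext_idem _ _ (idempotent_mulVl s)).
have := act_unit_mulV theta (iinv s); rewrite iinv_involutive => ->.
rewrite mulrA -act_unit_central.
by rewrite act_ext_unit.
Qed.

Fact crossed_ldual_linear t : linear (crossed_ldual t).
Proof.
by move=> c x y; rewrite [LHS]crossed_ldualD [X in X + _]crossed_ldualM.
Qed.

Fact crossed_rdual_linear t : linear (crossed_rdual t).
Proof.
by move=> c x y; rewrite [LHS]crossed_rdualD [X in X + _]crossed_rdualM.
Qed.

HB.instance Definition _ t :=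
  GRing.isLinear.Build A (lrestr (crossed_incl theta)) A^o *:%R
    (crossed_ldual t) (crossed_ldual_linear t).
HB.instance Definition _ t :=
  GRing.isLinear.Build A^c (rrestr (crossed_incl theta)) A^c^o *:%R
    (crossed_rdual t) (crossed_rdual_linear t).

Hypothesis S_EU : E_unitary S.

(** Both sides are the class of 1_r a delta_r for r = t t^-1 s. This r is below s since t t^-1 is
    idempotent, and below t since E-unitarity makes t^-1 s idempotent; moreover 1_r = 1_t 1_s. *)
Lemma cgen_bounded_below s t a :
  bounded_below s t -> cgen theta t ('u_s * a) = cgen theta s ('u_t * a).
Proof.
move=> st; pose r := (t * (iinv t * s))%g.
have rt : natural_le r t by exact/natural_le_mulr/E_unitary_Vmul.
have rs : natural_le r s.
  by rewrite /r mulgA; apply/natural_le_mull/idempotent_mulV.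
have uE b : 'u_r * b = 'u_t * ('u_s * b).
  rewrite /r mulgA act_unit_mul (act_ext_idem _ _ (idempotent_mulV t)).
  by rewrite act_unit_mulV -mulrA.
transitivity (cgen theta r a).
  by rewrite (cgen_le theta a rt) uE cgen_unit.
by rewrite (cgen_le theta a rs) uE act_unitCA cgen_unit.
Qed.

(** Gives both conditions of the criterion: the rank one map of t sends a delta_s to some a'
    delta_s, and for t = s the factor 1_s is absorbed. *)
Lemma crossed_ldual_fix t s a :
  crossed_incl theta (crossed_ldual t (cgen theta s a)) * cgen theta t 1 =
    cgen theta s (lcoef t s ('u_t * a)).
Proof.
rewrite crossed_inclMl mulr1 crossed_ldual_gen /lcoef.
case: asboolP => [st|_]; first exact: cgen_bounded_below.
by rewrite !cgen0.
Qed.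

(** Moving the coefficient across delta_t turns it into theta_(t s^-1)(a), which is 1_(t s^-1) a
    because t s^-1 is idempotent for congruent s and t. *)
Lemma crossed_rdual_fix t s a :
  cgen theta t 1 * crossed_incl theta (crossed_rdual t (cgen theta s a)) =
    cgen theta s (lcoef t s ('u_t * ('u_(t * iinv s)%g * a))).
Proof.
(* The factor 1_s is inserted first, since [cgen_bounded_below] needs it to pass from delta_t to
   delta_s. *)
rewrite -[cgen theta s a]cgen_unit crossed_inclMr mul1r crossed_rdual_gen.
rewrite /lcoef /rcoef.
case: asboolP => [st|_]; last first.
  by rewrite act_ext0 !cgen0.
rewrite -cgen_bounded_below // -act_ext_mul.
by rewrite (act_ext_idem _ _ (E_unitary_mulV S_EU st)) act_unitCA.
Qed.

Lemma lrestr_crossed_locally_projective :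
  locally_projective (lrestr (crossed_incl theta)).
Proof.
apply: (@stable_generators_locally_projective A
  (lrestr (crossed_incl theta)) S
  (fun s x => exists a, x = cgen theta s a)
  (fun t => crossed_ldual t : {linear lrestr (crossed_incl theta) -> A^o})
  (fun t => cgen theta t 1)).
- move=> s _ [a ->]; rewrite [LHS]crossed_ldual_fix /lcoef asboolT.
    by rewrite cgen_unit.
  exact: bounded_below_refl.
- move=> s t _ [a ->]; exists (a - lcoef t s ('u_t * a)).
  by rewrite cgenB -crossed_ldual_fix.
- by move=> P PD PG; apply: crossed_ind => // s a; apply: (PG s); exists a.
Qed.

Lemma rrestr_crossed_locally_projective :
  locally_projective (rrestr (crossed_incl theta)).
Proof.
apply: (@stable_generators_locally_projective A^c
  (rrestr (crossed_incl theta)) S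
  (fun s x => exists a, x = cgen theta s a)
  (fun t => crossed_rdual t : {linear rrestr (crossed_incl theta) -> A^c^o})
  (fun t => cgen theta t 1)).
- move=> s _ [a ->]; rewrite [LHS]crossed_rdual_fix /lcoef asboolT.
    by rewrite act_unit_mulV !cgen_unit.
  exact: bounded_below_refl.
- move=> s t _ [a ->].
  exists (a - lcoef t s ('u_t * ('u_(t * iinv s)%g * a))).
  by rewrite cgenB -crossed_rdual_fix.
- by move=> P PD PG; apply: crossed_ind => // s a; apply: (PG s); exists a.
Qed.

End CrossedProductDuals.

Theorem lemma4p22 (K : comPzRingType) (A : pzAlgType K) (S : invMonoidType)
    (theta : unital_action A S) :
  lflat (alg_mod A) -> E_unitary S ->
  lflat (env_lmod (crossed_incl theta)) /\
  rflat (env_rmod (crossed_incl theta)).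
Proof.
move=> _ S_EU.
have lpl := lrestr_crossed_locally_projective (theta := theta) S_EU.
have lpr := rrestr_crossed_locally_projective (theta := theta) S_EU.
split.
  exact/locally_projective_lflat/env_lmod_locally_projective.
exact/locally_projective_rflat/env_rmod_locally_projective.
Qed.
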